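(* Let $n\ge 4$ be a natural number and let $c\in k$ be arbitrary. Then the algebra $Q(2A)^{2^{n-2},c}$ has Morita--Frobenius number $1$ if and only if $Q(2A)^{2^{n-2},c}\cong Q(2A)^{2^{n-2},\tilde c}$ as $k$-algebras for some $\tilde c\in\mathbb{F}_2$.
   Context: $k\cong\overline{\mathbb{F}}_2$. For an integer $s\ge 2$ and $c\in k$, $Q(2A)^{s,c}$ is the $k$-algebra given by the quiver with two vertices $0,1$, a loop $\alpha$ at $0$, an arrow $\beta$ from $0$ to $1$ and an arrow $\gamma$ from $1$ to $0$ (paths are written from left to right, so $\beta\gamma$ is a closed path at $0$), subject to the relations $$\gamma\beta\gamma=(\gamma\alpha\beta)^{s-1}\gamma\alpha,\quad \beta\gamma\beta=(\alpha\beta\gamma)^{s-1}\alpha\beta,\quad \alpha^2=(\beta\gamma\alpha)^{s-1}\beta\gamma+c(\beta\gamma\alpha)^s,\quad \alpha^2\beta=0.$$ The Morita--Frobenius number of a finite-dimensional $k$-algebra $A$ is the smallest $m\ge1$ such that $A$ is Morita equivalent (as a $k$-algebra) to its $m$-th Frobenius twist, i.e. the same ring with the $k$-action twisted by the $m$-th power of the Frobenius automorphism; the first Frobenius twist of $Q(2A)^{s,c}$ is $Q(2A)^{s,c^2}$. *)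

(* Defs.v *)
From HB Require Import structures.
From mathcomp Require Import all_boot all_order all_algebra.
From mathcomp Require Import boolp.
From mathcomp Require Import finmap monalg.

Set Implicit Arguments.
Unset Strict Implicit.
Unset Printing Implicit Defensive.

Import GRing.Theory.
Local Open Scope fset_scope.
Local Open Scope ring_scope.

Record quiver := Quiver {
  qvertex : finType;
  qarrow : finType;
  qsrc : qarrow -> qvertex;
  qtgt : qarrow -> qvertex;
  qvertex_gt0 : (0 < #|qvertex|)%N }.

Section Paths.
Variable Q : quiver.
Implicit Types (v : qvertex Q) (s t : seq (qarrow Q)).

Fixpoint is_walk v s : bool :=
  if s is a :: s' then (qsrc a == v) && is_walk (qtgt a) s' else true.

Definition walk_end v s := last v (map (@qtgt Q) s).

Lemma is_walk_cat v s t : is_walk v (s ++ t) = is_walk v s && is_walk (walk_end v s) t.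
Proof. by elim: s v => //= a s IH v; rewrite IH andbA. Qed.

Lemma walk_end_cat v s t : walk_end v (s ++ t) = walk_end (walk_end v s) t.
Proof. by rewrite /walk_end map_cat last_cat. Qed.

(* A path is a start vertex with the sequence of its arrows, written from   *)
(* left to right; the start vertex distinguishes the trivial paths.         *)
Record qpath := QPath {
  qpval : qvertex Q * seq (qarrow Q);
  qpvalP : is_walk qpval.1 qpval.2 }.

HB.instance Definition _ := [isSub for qpval].
HB.instance Definition _ := [Choice of qpath by <:].

Implicit Types p q r : qpath.

Definition path_start p := (qpval p).1.
Definition path_arrows p := (qpval p).2.
Definition path_end p := walk_end (path_start p) (path_arrows p).

Definition trivial_path v : qpath := @QPath (v, [::]) isT.

Lemma arrow_path_subproof (a : qarrow Q) : is_walk (qsrc a) [:: a].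
Proof. by rewrite /= eqxx. Qed.

Definition arrow_path (a : qarrow Q) : qpath :=
  @QPath (qsrc a, [:: a]) (arrow_path_subproof a).

(* [None] stands for the zero product of non-composable paths; when the     *)
(* ends match, [insub] always succeeds (lemma [path_compE]).                *)
Definition path_comp p q : option qpath :=
  if path_end p == path_start q
  then insub (path_start p, path_arrows p ++ path_arrows q) else None.

Lemma path_comp_subproof p q : path_end p = path_start q ->
  is_walk (path_start p) (path_arrows p ++ path_arrows q).
Proof.
move=> e; rewrite is_walk_cat (qpvalP p) -/(path_end p) e; exact: (qpvalP q).
Qed.

Lemma path_compE p q (e : path_end p = path_start q) :
  path_comp p q =
  Some (@QPath (path_start p, path_arrows p ++ path_arrows q)
               (path_comp_subproof e)).
Proof.
rewrite /path_comp e eqxx; case: insubP => /= [u _ uE|].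
  by congr Some; apply: val_inj.
by rewrite path_comp_subproof.
Qed.

Variant path_comp_spec p q : option qpath -> Type :=
| PathCompSome r of path_end p = path_start q
    & qpval r = (path_start p, path_arrows p ++ path_arrows q)
    : path_comp_spec p q (Some r)
| PathCompNone of path_end p != path_start q : path_comp_spec p q None.

Lemma path_compP p q : path_comp_spec p q (path_comp p q).
Proof.
case: (eqVneq (path_end p) (path_start q)) => [e|ne].
  by rewrite (path_compE e); constructor.
by rewrite /path_comp (negbTE ne); constructor.
Qed.

Lemma path_compA p q r :
  obind (path_comp p) (path_comp q r) = obind (path_comp^~ r) (path_comp p q).
Proof.
have E x y z : qpval z = (path_start x, path_arrows x ++ path_arrows y) ->
    path_end x = path_start y ->
  [/\ path_start z = path_start x, path_end z = path_end y
    & path_arrows z = path_arrows x ++ path_arrows y].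
  move=> zE exy; rewrite /path_end /path_start /path_arrows zE; split=> //=.
  by rewrite walk_end_cat -/(path_end x) exy.
case: (path_compP q r) => [qr e1 /E/(_ e1)[s1 t1 a1]|n1];
  case: (path_compP p q) => [pq e2 /E/(_ e2)[s2 t2 a2]|n2] //=.
- case: (path_compP p qr) => [u e3 uE|]; last by rewrite s1 e2 eqxx.
  case: (path_compP pq r) => [w e4 wE|]; last by rewrite t2 e1 eqxx.
  by congr Some; apply: val_inj; rewrite /= uE wE s2 a1 a2 catA.
- by case: (path_compP p qr) => // u; rewrite s1 => e; rewrite e eqxx in n2.
- by case: (path_compP pq r) => // u; rewrite t2 => e; rewrite e eqxx in n1.
Qed.

Lemma path_comp1p v p :
  path_comp (trivial_path v) p = if v == path_start p then Some p else None.
Proof.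
have -> : (v == path_start p) = (path_end (trivial_path v) == path_start p) by [].
case: path_compP => [r e rE|/negbTE-> //]; rewrite e eqxx; congr Some.
apply: val_inj; rewrite /= rE [RHS]surjective_pairing -/(path_start p) -e.
by [].
Qed.

Lemma path_compp1 v p :
  path_comp p (trivial_path v) = if v == path_end p then Some p else None.
Proof.
have -> : (v == path_end p) = (path_end p == path_start (trivial_path v)).
  by rewrite eq_sym.
case: path_compP => [r e rE|/negbTE-> //]; rewrite e eqxx; congr Some.
by apply: val_inj; rewrite /= rE cats0 -surjective_pairing.
Qed.

End Paths.

Definition path_algebra (k : fieldType) (Q : quiver) : Type :=
  {malg k[qpath Q]}.

HB.instance Definition _ (k : fieldType) (Q : quiver) :=
  GRing.Lmodule.copy (path_algebra k Q) {malg k[qpath Q]}.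

Section PathAlgebra.
Variables (k : fieldType) (Q : quiver).
Local Notation kQ := (path_algebra k Q).
Implicit Types (x y z : kQ) (p q r : qpath Q) (c d : k).

(* [path_elt] and [pa_mul] are locked because unification would otherwise    *)
(* unfold them down to finite maps.                                          *)
Definition path_elt : k -> qpath Q -> kQ := locked (fun c p => << c *g p >>).

Lemma path_eltE c p : path_elt c p = << c *g p >>.
Proof. by rewrite /path_elt -lock. Qed.

Definition opath_elt c (op : option (qpath Q)) : kQ :=
  if op is Some p then path_elt c p else 0.

Definition pa_one : kQ := \sum_(v : qvertex Q) path_elt 1 (trivial_path v).

Definition pa_mul : kQ -> kQ -> kQ := locked (fun x y =>
  \sum_(p <- msupp x) \sum_(q <- msupp y)
     opath_elt (x@_p * y@_q) (path_comp p q)).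

Lemma pa_mulE x y : pa_mul x y =
  \sum_(p <- msupp x) \sum_(q <- msupp y)
     opath_elt (x@_p * y@_q) (path_comp p q).
Proof. by rewrite /pa_mul -lock. Qed.

Lemma opath_elt0 op : opath_elt 0 op = 0.
Proof. by case: op => //= p; rewrite path_eltE; exact: monalgU0. Qed.

Lemma opath_eltD c d op : opath_elt (c + d) op = opath_elt c op + opath_elt d op.
Proof. by case: op => [p|] /=; rewrite ?addr0 // !path_eltE; exact: monalgUD. Qed.

Lemma opath_eltZ c d op : c *: opath_elt d op = opath_elt (c * d) op.
Proof.
case: op => [p|] /=; last by rewrite scaler0.
have E : c *: (<< d *g p >> : {malg k[qpath Q]}) = << c * d *g p >>.
  apply/malgP => q; rewrite mcoeffZ.
  rewrite [in LHS]mcoeffU.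
  rewrite [in RHS]mcoeffU.
  exact: mulrnAr.
by rewrite !path_eltE; exact: E.
Qed.

Lemma pa_mulw (d1 d2 : {fset qpath Q}) x y :
  msupp x `<=` d1 -> msupp y `<=` d2 ->
  pa_mul x y =
  \sum_(p <- d1) \sum_(q <- d2) opath_elt (x@_p * y@_q) (path_comp p q).
Proof.
move=> le1 le2; rewrite pa_mulE (big_fset_incl _ le1) /=.
  apply/eq_bigr=> p _; apply/big_fset_incl => // q _ /mcoeff_outdom ->.
  by rewrite mulr0 opath_elt0.
move=> p _ /mcoeff_outdom xp.
by rewrite big1 => // q _; rewrite xp mul0r opath_elt0.
Qed.

Lemma pa_mulDl : left_distributive pa_mul +%R.
Proof.
move=> x y z; have sz := fsubset_refl (msupp z).
rewrite [in RHS](pa_mulw (fsubsetUl _ (msupp y)) sz).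
rewrite [in RHS](pa_mulw (fsubsetUr (msupp x) _) sz).
rewrite (pa_mulw (msuppD_le _ _) sz) -big_split /=; apply/eq_bigr=> p _.
rewrite -big_split /=; apply/eq_bigr=> q _.
by rewrite mcoeffD mulrDl opath_eltD.
Qed.

Lemma pa_mulDr : right_distributive pa_mul +%R.
Proof.
move=> z x y; have sz := fsubset_refl (msupp z).
rewrite [in RHS](pa_mulw sz (fsubsetUl _ (msupp y))).
rewrite [in RHS](pa_mulw sz (fsubsetUr (msupp x) _)).
rewrite (pa_mulw sz (msuppD_le _ _)) -big_split /=; apply/eq_bigr=> p _.
rewrite -big_split /=; apply/eq_bigr=> q _.
by rewrite mcoeffD mulrDr opath_eltD.
Qed.

Lemma pa_mul0l : left_zero 0 pa_mul.
Proof. by move=> x; rewrite pa_mulE msupp0 big_seq_fset0. Qed.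

Lemma pa_mul0r : right_zero 0 pa_mul.
Proof.
by move=> x; rewrite pa_mulE big1 // => p _; rewrite msupp0 big_seq_fset0.
Qed.

Lemma pa_mulUU c d p q :
  pa_mul (path_elt c p) (path_elt d q) = opath_elt (c * d) (path_comp p q).
Proof.
rewrite 2!path_eltE (pa_mulw msuppU_le msuppU_le).
by rewrite !big_seq_fset1 !mcoeffUU.
Qed.

Lemma path_algebra_ind (P : kQ -> Prop) :
  P 0 -> (forall x y, P x -> P y -> P (x + y)) ->
  (forall c p, P (path_elt c p)) -> forall x, P x.
Proof.
move=> P0 PD PU x; rewrite [x]monalgE.
by elim/big_ind: _ => // p _; rewrite -path_eltE; exact: PU.
Qed.

Lemma pa_mulA : associative pa_mul.
Proof.
have stepr u v : (forall e r, pa_mul u (pa_mul v (path_elt e r)) =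
    pa_mul (pa_mul u v) (path_elt e r)) ->
  forall z, pa_mul u (pa_mul v z) = pa_mul (pa_mul u v) z.
  move=> H; elim/path_algebra_ind => [|z z' IH IH'|//].
    by rewrite !pa_mul0r.
  by rewrite !pa_mulDr IH IH'.
have stepm u z : (forall d q, pa_mul u (pa_mul (path_elt d q) z) =
    pa_mul (pa_mul u (path_elt d q)) z) ->
  forall y, pa_mul u (pa_mul y z) = pa_mul (pa_mul u y) z.
  move=> H; elim/path_algebra_ind => [|y y' IH IH'|//].
    by rewrite pa_mul0l pa_mul0r pa_mul0l.
  by rewrite pa_mulDl !pa_mulDr IH IH' pa_mulDl.
have stepl y z : (forall c p, pa_mul (path_elt c p) (pa_mul y z) =
    pa_mul (pa_mul (path_elt c p) y) z) ->
  forall x, pa_mul x (pa_mul y z) = pa_mul (pa_mul x y) z.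
  move=> H; elim/path_algebra_ind => [|x x' IH IH'|//].
    by rewrite !pa_mul0l.
  by rewrite !pa_mulDl IH IH'.
move=> x y z; apply: stepl => c p; apply: stepm => d q; apply: stepr => e r.
rewrite !pa_mulUU; have := path_compA p q r.
case: (path_comp q r) => [qr|]; case: (path_comp p q) => [pq|] /=.
- by rewrite !pa_mulUU mulrA => ->.
- by rewrite pa_mul0l pa_mulUU => ->.
- by rewrite pa_mul0r pa_mulUU => <-.
- by rewrite pa_mul0l pa_mul0r.
Qed.

Lemma pa_mul_onel p c : pa_mul pa_one (path_elt c p) = path_elt c p.
Proof.
rewrite /pa_one (big_morph (pa_mul^~ _) (fun _ _ => pa_mulDl _ _ _) (pa_mul0l _)).
rewrite (bigD1 (path_start p)) //= big1 => [|v nv].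
  by rewrite pa_mulUU mul1r path_comp1p eqxx addr0.
by rewrite pa_mulUU path_comp1p (negbTE nv).
Qed.

Lemma pa_mul_oner p c : pa_mul (path_elt c p) pa_one = path_elt c p.
Proof.
rewrite /pa_one (big_morph (pa_mul _) (fun _ _ => pa_mulDr _ _ _) (pa_mul0r _)).
rewrite (bigD1 (path_end p)) //= big1 => [|v nv].
  by rewrite pa_mulUU mulr1 path_compp1 eqxx addr0.
by rewrite pa_mulUU path_compp1 (negbTE nv).
Qed.

Lemma pa_mul1l : left_id pa_one pa_mul.
Proof.
elim/path_algebra_ind => [|x y IH IH'|c p]; first exact: pa_mul0r.
  by rewrite pa_mulDr IH IH'.
exact: pa_mul_onel.
Qed.

Lemma pa_mul1r : right_id pa_one pa_mul.
Proof.
elim/path_algebra_ind => [|x y IH IH'|c p]; first exact: pa_mul0l.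
  by rewrite pa_mulDl IH IH'.
exact: pa_mul_oner.
Qed.

Lemma pa_scaleAl c x y : c *: pa_mul x y = pa_mul (c *: x) y.
Proof.
rewrite (pa_mulw (msuppZ_le c x) (fsubset_refl _)) pa_mulE scaler_sumr.
apply: eq_bigr => p _; rewrite scaler_sumr; apply: eq_bigr => q _.
by rewrite opath_eltZ mcoeffZ mulrA.
Qed.

Lemma pa_scaleAr c x y : c *: pa_mul x y = pa_mul x (c *: y).
Proof.
rewrite (pa_mulw (fsubset_refl _) (msuppZ_le c y)) pa_mulE scaler_sumr.
apply: eq_bigr => p _; rewrite scaler_sumr; apply: eq_bigr => q _.
by rewrite opath_eltZ mcoeffZ mulrCA.
Qed.

Lemma pa_one_coef v : pa_one@_(trivial_path v) = 1.
Proof.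
rewrite /pa_one raddf_sum (bigD1 v) //= path_eltE mcoeffUU big1 ?addr0 // => w nw.
rewrite path_eltE mcoeffU; case: eqP => // /(congr1 (@path_start Q)) /= e.
by rewrite /path_start /= in e; rewrite e eqxx in nw.
Qed.

Lemma pa_one_neq0 : pa_one != 0.
Proof.
have /card_gt0P[v _] := qvertex_gt0 Q; apply/eqP => e.
by have /eqP := pa_one_coef v; rewrite e mcoeff0 eq_sym oner_eq0.
Qed.

HB.instance Definition _ := GRing.Zmodule_isNzRing.Build kQ
  pa_mulA pa_mul1l pa_mul1r pa_mulDl pa_mulDr pa_one_neq0.
HB.instance Definition _ := GRing.Lmodule_isLalgebra.Build k kQ pa_scaleAl.
HB.instance Definition _ := GRing.Lalgebra_isAlgebra.Build k kQ pa_scaleAr.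

Definition vertex_elt (v : qvertex Q) : kQ := path_elt 1 (trivial_path v).
Definition arrow_elt (a : qarrow Q) : kQ := path_elt 1 (arrow_path a).

Lemma trivial_coef_path_elt v c p :
  (path_elt c p)@_(trivial_path v) = c *+ (p == trivial_path v).
Proof. by rewrite path_eltE mcoeffU. Qed.

Lemma trivial_coef_comp v c p q :
  (opath_elt c (path_comp p q))@_(trivial_path v) =
  c *+ ((p == trivial_path v) && (q == trivial_path v)).
Proof.
case: path_compP => [r e rE|ne] /=; last first.
  rewrite mcoeff0; case: andP => [[/eqP ep /eqP eq]|//].
  by rewrite ep eq eqxx in ne.
rewrite trivial_coef_path_elt; congr (_ *+ nat_of_bool _).
rewrite -!val_eqE /= rE /path_start /path_arrows.
have : path_end p = (qpval q).1 by [].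
rewrite /path_end /path_start /path_arrows /walk_end.
case: (qpval p) (qpval q) => [u [|a l]] [w t] /=; last by rewrite !xpair_eqE !andbF.
by move=> ->; rewrite !xpair_eqE eqxx andbT; case: eqP.
Qed.

Lemma trivial_coefM v x y :
  (x * y)@_(trivial_path v) = x@_(trivial_path v) * y@_(trivial_path v).
Proof.
rewrite -[x * y]/(pa_mul x y).
elim/path_algebra_ind: x => [|x x' IH IH'|c p].
- by rewrite pa_mul0l mcoeff0 mul0r.
- by rewrite pa_mulDl !mcoeffD IH IH' mulrDl.
elim/path_algebra_ind: y => [|y y' IH IH'|d q].
- by rewrite pa_mul0r mcoeff0 mulr0.
- by rewrite pa_mulDr !mcoeffD IH IH' mulrDr.
rewrite pa_mulUU trivial_coef_comp !trivial_coef_path_elt.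
by case: eqP; case: eqP; rewrite ?mulr0n ?mulr1n ?mul0r ?mulr0.
Qed.

Lemma trivial_coef_arrow v a : (arrow_elt a)@_(trivial_path v) = 0.
Proof. by rewrite trivial_coef_path_elt -val_eqE /= xpair_eqE andbF. Qed.

End PathAlgebra.

(* Closure under opposites follows from [- x = (- 1) * x]; an ideal of a    *)
(* unital algebra is likewise stable under scalars.                         *)
Definition two_sided_ideal (A : pzRingType) (I : A -> Prop) : Prop :=
  [/\ I 0, (forall x y, I x -> I y -> I (x + y))
    & forall a x, I x -> I (a * x) /\ I (x * a)].

Definition ideal_generated (A : pzRingType) (S : A -> Prop) : A -> Prop :=
  fun x => forall I, two_sided_ideal I -> (forall y, S y -> I y) -> I x.

Lemma ideal_generatedP (A : pzRingType) (S : A -> Prop) :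
  two_sided_ideal (ideal_generated S).
Proof.
split=> [I [] // | x y Sx Sy I iI SI | a x Sx].
  by have [_ D _] := iI; apply: D; [apply: Sx | apply: Sy].
by split=> I iI SI; have [_ _ M] := iI; have [] := M a x (Sx I iI SI).
Qed.

Record proper_two_sided_ideal (A : pzRingType) := ProperTwoSidedIdeal {
  tsideal :> A -> Prop;
  tsidealP : two_sided_ideal tsideal;
  tsideal_proper : ~ tsideal 1 }.

Section QuotientAlgebra.
Variables (k : fieldType) (A : algType k) (I : proper_two_sided_ideal A).

Definition tsideal_mem : A -> bool := fun x => `[< I x >].

Lemma tsideal_zmod_closed : zmod_closed tsideal_mem.
Proof.
have [I0 ID IM] := tsidealP I.
split; rewrite /in_mem /= ?/tsideal_mem; first exact/asboolP.
move=> x y /asboolP Ix /asboolP Iy; apply/asboolP; apply: ID => //.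
by rewrite -mulN1r; have [] := IM (-1) y Iy.
Qed.

HB.instance Definition _ :=
  GRing.isZmodClosed.Build A tsideal_mem tsideal_zmod_closed.

Definition tsideal_zmodClosed : zmodClosed A :=
  GRing.ZmodClosed.clone A tsideal_mem _.

Definition quotient_algebra : Type := Quotient.quot tsideal_zmodClosed.

HB.instance Definition _ := GRing.Zmodule.on quotient_algebra.

Local Notation Q := quotient_algebra.

Definition quotient_proj : A -> Q := \pi_(Quotient.quot tsideal_zmodClosed)%qT.
Definition quotient_repr : Q -> A := fun x => repr (x : Quotient.quot tsideal_zmodClosed).

Lemma quotient_reprK : cancel quotient_repr quotient_proj.
Proof. exact: reprK. Qed.

Lemma quotient_proj_eq x y : quotient_proj x = quotient_proj y <-> I (x - y).
Proof.
rewrite /quotient_proj; split=> [/eqP|Ixy].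
  by rewrite -Quotient.idealrBE => /asboolP.
by apply/eqP; rewrite -Quotient.idealrBE; apply/asboolP.
Qed.

Lemma quotient_projD : {morph quotient_proj : x y / x + y}.
Proof. exact: Quotient.pi_add. Qed.

Definition quotient_one : Q := quotient_proj 1.
Definition quotient_mul (x y : Q) : Q :=
  quotient_proj (quotient_repr x * quotient_repr y).
Definition quotient_scale (c : k) (x : Q) : Q :=
  quotient_proj (c *: quotient_repr x).

Lemma quotient_proj0 : quotient_proj 0 = 0.
Proof. by apply: (addIr (quotient_proj 0)); rewrite -quotient_projD !add0r. Qed.

Lemma quotient_reprE x : I (quotient_repr (quotient_proj x) - x).
Proof. by apply/quotient_proj_eq; rewrite quotient_reprK. Qed.

Lemma quotient_projM x y :
  quotient_proj (x * y) = quotient_mul (quotient_proj x) (quotient_proj y).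
Proof.
have [I0 ID IM] := tsidealP I; apply/esym/quotient_proj_eq.
set x' := quotient_repr _; set y' := quotient_repr _.
have -> : x' * y' - x * y = (x' - x) * y' + x * (y' - y).
  by rewrite mulrBl mulrBr addrA subrK.
by apply: ID; [have [] := IM y' _ (quotient_reprE x)
              |have [] := IM x _ (quotient_reprE y)].
Qed.

Lemma quotient_projZ c x :
  quotient_proj (c *: x) = quotient_scale c (quotient_proj x).
Proof.
have [I0 ID IM] := tsidealP I; apply/esym/quotient_proj_eq.
rewrite -scalerBr -[X in I X]mul1r -scalerAr scalerAl.
by have [] := IM (c *: 1) _ (quotient_reprE x).
Qed.

Lemma quotient_ind (P : Q -> Prop) :
  (forall x, P (quotient_proj x)) -> forall x, P x.
Proof. by move=> H x; rewrite -[x]quotient_reprK. Qed.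

Lemma quotient_mulA : associative quotient_mul.
Proof.
move=> x y z; elim/quotient_ind: x => x; elim/quotient_ind: y => y.
by elim/quotient_ind: z => z; rewrite -!quotient_projM mulrA.
Qed.

Lemma quotient_mul1l : left_id quotient_one quotient_mul.
Proof. by elim/quotient_ind=> x; rewrite -quotient_projM mul1r. Qed.

Lemma quotient_mul1r : right_id quotient_one quotient_mul.
Proof. by elim/quotient_ind=> x; rewrite -quotient_projM mulr1. Qed.

Lemma quotient_mulDl : left_distributive quotient_mul +%R.
Proof.
move=> x y z; elim/quotient_ind: x => x; elim/quotient_ind: y => y.
elim/quotient_ind: z => z.
by rewrite -quotient_projD -!quotient_projM -quotient_projD mulrDl.
Qed.

Lemma quotient_mulDr : right_distributive quotient_mul +%R.
Proof.
move=> x y z; elim/quotient_ind: x => x; elim/quotient_ind: y => y.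
elim/quotient_ind: z => z.
by rewrite -quotient_projD -!quotient_projM -quotient_projD mulrDr.
Qed.

Lemma quotient_one_neq0 : quotient_one != 0.
Proof.
apply/eqP; rewrite -quotient_proj0 => /quotient_proj_eq.
by rewrite subr0; exact: tsideal_proper.
Qed.

HB.instance Definition _ := GRing.Zmodule_isNzRing.Build Q
  quotient_mulA quotient_mul1l quotient_mul1r quotient_mulDl quotient_mulDr
  quotient_one_neq0.

Lemma quotient_scaleA a b x :
  quotient_scale a (quotient_scale b x) = quotient_scale (a * b) x.
Proof. by elim/quotient_ind: x => x; rewrite -!quotient_projZ scalerA. Qed.

Lemma quotient_scale1 : left_id 1 quotient_scale.
Proof. by elim/quotient_ind => x; rewrite -quotient_projZ scale1r. Qed.

Lemma quotient_scaleDr : right_distributive quotient_scale +%R.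
Proof.
move=> a x y; elim/quotient_ind: x => x; elim/quotient_ind: y => y.
by rewrite -quotient_projD -!quotient_projZ -quotient_projD scalerDr.
Qed.

Lemma quotient_scaleDl x : {morph quotient_scale^~ x : a b / a + b}.
Proof.
move=> a b; elim/quotient_ind: x => x.
by rewrite -!quotient_projZ -quotient_projD scalerDl.
Qed.

HB.instance Definition _ := GRing.Zmodule_isLmodule.Build k Q
  quotient_scaleA quotient_scale1 quotient_scaleDr quotient_scaleDl.

Lemma quotient_scaleAl (a : k) (x y : Q) : a *: (x * y) = (a *: x) * y.
Proof.
elim/quotient_ind: x => x; elim/quotient_ind: y => y.
rewrite -[LHS]/(quotient_scale a (quotient_mul _ _)).
rewrite -[RHS]/(quotient_mul (quotient_scale a _) _).
by rewrite -quotient_projM -!quotient_projZ -quotient_projM scalerAl.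
Qed.

Lemma quotient_scaleAr (a : k) (x y : Q) : a *: (x * y) = x * (a *: y).
Proof.
elim/quotient_ind: x => x; elim/quotient_ind: y => y.
rewrite -[LHS]/(quotient_scale a (quotient_mul _ _)).
rewrite -[RHS]/(quotient_mul _ (quotient_scale a _)).
by rewrite -quotient_projM -!quotient_projZ -quotient_projM scalerAr.
Qed.

HB.instance Definition _ := GRing.Lmodule_isLalgebra.Build k Q quotient_scaleAl.
HB.instance Definition _ := GRing.Lalgebra_isAlgebra.Build k Q quotient_scaleAr.

End QuotientAlgebra.

Variant vertex2A := V0 | V1.
Variant arrow2A := Alpha | Beta | Gamma.

Definition vertex2A_code (v : vertex2A) : bool := if v is V0 then true else false.
Definition vertex2A_decode (b : bool) : vertex2A := if b then V0 else V1.
Lemma vertex2A_codeK : cancel vertex2A_code vertex2A_decode. Proof. by case. Qed.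
HB.instance Definition _ := Finite.copy vertex2A (can_type vertex2A_codeK).

Definition arrow2A_code (a : arrow2A) : option bool :=
  match a with Alpha => None | Beta => Some true | Gamma => Some false end.
Definition arrow2A_decode (o : option bool) : arrow2A :=
  match o with None => Alpha | Some true => Beta | Some false => Gamma end.
Lemma arrow2A_codeK : cancel arrow2A_code arrow2A_decode. Proof. by case. Qed.
HB.instance Definition _ := Finite.copy arrow2A (can_type arrow2A_codeK).

Lemma vertex2A_gt0 : (0 < #|{: vertex2A}|)%N.
Proof. by apply/card_gt0P; exists V0. Qed.

Definition quiver2A : quiver := {|
  qvertex := vertex2A; qarrow := arrow2A;
  qsrc := fun a => match a with Alpha => V0 | Beta => V0 | Gamma => V1 end;
  qtgt := fun a => match a with Alpha => V0 | Beta => V1 | Gamma => V0 end;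
  qvertex_gt0 := vertex2A_gt0 |}.

Section Q2A.
Variables (k : fieldType) (s : nat) (c : k).

Let a : path_algebra k quiver2A := arrow_elt k (Alpha : qarrow quiver2A).
Let b : path_algebra k quiver2A := arrow_elt k (Beta : qarrow quiver2A).
Let g : path_algebra k quiver2A := arrow_elt k (Gamma : qarrow quiver2A).

(* A relation [x = y] is encoded as [x - y]. The power (b g a)^s is written *)
(* (b g a)^(s - 1) (b g a), which keeps all relations inside the arrow      *)
(* ideal even for the irrelevant value s = 0.                               *)
Variant Q2A_relation : path_algebra k quiver2A -> Prop :=
| Q2A_gbg : Q2A_relation
    (g * b * g - (g * a * b) ^+ s.-1 * (g * a))
| Q2A_bgb : Q2A_relation
    (b * g * b - (a * b * g) ^+ s.-1 * (a * b))
| Q2A_aa : Q2A_relation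
    (a ^+ 2 - ((b * g * a) ^+ s.-1 * (b * g)
               + c *: ((b * g * a) ^+ s.-1 * (b * g * a))))
| Q2A_aab : Q2A_relation (a ^+ 2 * b).

Lemma Q2A_proper : ~ ideal_generated Q2A_relation 1.
Proof.
pose J (x : path_algebra k quiver2A) := x@_(trivial_path (V0 : qvertex quiver2A)) = 0.
move/(_ J) => H; have : J 1.
  apply: H.
    split=> [|x y Jx Jy|z x Jx]; rewrite /J ?mcoeff0 //.
      by rewrite mcoeffD Jx Jy addr0.
    by rewrite !trivial_coefM Jx mul0r mulr0.
  move=> y [] ; rewrite /J ?mcoeffB ?mcoeffD ?mcoeffZ ?expr2 !trivial_coefM;
    by rewrite !trivial_coef_arrow ?(mulr0, mul0r, subr0, addr0).
by rewrite /J => /eqP; rewrite pa_one_coef oner_eq0.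
Qed.

Definition Q2A : algType k := quotient_algebra
  (ProperTwoSidedIdeal (ideal_generatedP Q2A_relation) Q2A_proper).

End Q2A.

Definition algebra_isomorphic (k : fieldType) (A B : algType k) : Prop :=
  exists f : {lrmorphism A -> B}, bijective f.

(* Functors between categories of left modules; morphisms are compared      *)
(* pointwise.                                                               *)
Record module_functor (A B : pzRingType) := ModuleFunctor {
  fobj :> lmodType A -> lmodType B;
  fmap : forall M N : lmodType A, {linear M -> N} -> {linear fobj M -> fobj N};
  fmap_ext : forall (M N : lmodType A) (f g : {linear M -> N}),
    f =1 g -> fmap f =1 fmap g;
  fmap_id : forall M : lmodType A, fmap (idfun : {linear M -> M}) =1 id;
  fmap_comp : forall (M N P : lmodType A)
      (g : {linear N -> P}) (f : {linear M -> N}),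
    fmap (g \o f : {linear M -> P}) =1 fmap g \o fmap f }.

(* The k-structure on Hom_A(M, N) is [(c f) m = (c 1_A) (f m)].             *)
Definition k_linear_functor (k : fieldType) (A B : algType k)
    (F : module_functor A B) : Prop :=
  (forall (M N : lmodType A) (f g h : {linear M -> N}),
     (forall m, h m = f m + g m) ->
     forall m, fmap F h m = fmap F f m + fmap F g m) /\
  (forall (M N : lmodType A) (c : k) (f h : {linear M -> N}),
     (forall m, h m = c%:A *: f m) ->
     forall m, fmap F h m = c%:A *: fmap F f m).

Definition quasi_inverse (A B : pzRingType)
    (F : module_functor A B) (G : module_functor B A) : Prop :=
  exists2 eta : forall M : lmodType A, {linear M -> G (F M)},
    (forall M, bijective (eta M)) &
    forall (M N : lmodType A) (f : {linear M -> N}) (m : M),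
      eta N (f m) = fmap G (fmap F f) (eta M m).

Definition morita_equivalent (k : fieldType) (A B : algType k) : Prop :=
  exists (F : module_functor A B) (G : module_functor B A),
    [/\ k_linear_functor F, k_linear_functor G,
        quasi_inverse F G & quasi_inverse G F].

(* The m-th Frobenius twist is the ring A on which c in k acts as           *)
(* c^(1 / p^m) does on A (see [twist_scale]); so if A is given by quiver    *)
(* and relations, its first twist is given by the relations with            *)
(* coefficients raised to the p-th power.                                   *)
Definition frobenius_twist (k : closedFieldType) (p : nat)
  (pchark : p \in [pchar k]) (m : nat) (A : algType k) : Type := A.

Section FrobeniusTwist.
Variables (k : closedFieldType) (p : nat) (pchark : p \in [pchar k]).

Lemma frobenius_inv_subproof (m : nat) (x : k) : exists y, y ^+ (p ^ m) == x.
Proof.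
have q_gt0 : (0 < p ^ m)%N by rewrite expn_gt0 prime_gt0 // (pcharf_prime pchark).
have [y yE] := solve_monicpoly (fun i => if i is 0 then x else 0) q_gt0.
exists y; rewrite yE -(prednK q_gt0) big_ord_recl /= expr0 mulr1.
by rewrite big1 ?addr0 // => i _; rewrite mul0r.
Qed.

(* The inverse of the m-th power of the Frobenius automorphism of k.        *)
Definition frobenius_inv (m : nat) (x : k) : k :=
  xchoose (frobenius_inv_subproof m x).

Lemma frobenius_invK (m : nat) (x : k) : frobenius_inv m x ^+ (p ^ m) = x.
Proof. exact/eqP/(xchooseP (frobenius_inv_subproof m x)). Qed.

Lemma frobeniusD (m : nat) (x y : k) :
  (x + y) ^+ (p ^ m) = x ^+ (p ^ m) + y ^+ (p ^ m).
Proof.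
apply: exprDn_pchar; rewrite pnatX; apply/orP; left.
by rewrite pnatE // (pcharf_prime pchark).
Qed.

Lemma frobenius_inj (m : nat) : injective (fun x : k => x ^+ (p ^ m)).
Proof.
move=> x y /= e; apply/eqP; rewrite -subr_eq0.
have p_gt0 := prime_gt0 (pcharf_prime pchark).
have : (x - y) ^+ (p ^ m) + y ^+ (p ^ m) = y ^+ (p ^ m).
  by rewrite -frobeniusD subrK.
rewrite -[RHS]add0r => /addIr/eqP.
by rewrite expf_eq0 expn_gt0 p_gt0.
Qed.

Lemma frobenius_inv_is_zmod_morphism (m : nat) : zmod_morphism (frobenius_inv m).
Proof.
have fD x y : frobenius_inv m (x + y) = frobenius_inv m x + frobenius_inv m y.
  by apply: (@frobenius_inj m); rewrite /= frobeniusD !frobenius_invK.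
move=> x y; apply: (addIr (frobenius_inv m y)).
by rewrite -fD !subrK.
Qed.

Lemma frobenius_inv_is_monoid_morphism (m : nat) :
  monoid_morphism (frobenius_inv m).
Proof.
split=> [|x y]; apply: (@frobenius_inj m) => /=.
  by rewrite frobenius_invK expr1n.
by rewrite exprMn !frobenius_invK.
Qed.

HB.instance Definition _ (m : nat) := GRing.isZmodMorphism.Build k k
  (frobenius_inv m) (frobenius_inv_is_zmod_morphism m).
HB.instance Definition _ (m : nat) := GRing.isMonoidMorphism.Build k k
  (frobenius_inv m) (frobenius_inv_is_monoid_morphism m).

Section Twist.
Variables (m : nat) (A : algType k).
Local Notation Am := (frobenius_twist pchark m A).

HB.instance Definition _ := GRing.NzRing.copy Am A.

Definition twist_scale (c : k) (x : Am) : Am := frobenius_inv m c *: (x : A).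

Lemma twist_scaleA a b x :
  twist_scale a (twist_scale b x) = twist_scale (a * b) x.
Proof. by rewrite /twist_scale scalerA rmorphM. Qed.

Lemma twist_scale1 : left_id 1 twist_scale.
Proof. by move=> x; rewrite /twist_scale rmorph1 scale1r. Qed.

Lemma twist_scaleDr : right_distributive twist_scale +%R.
Proof. by move=> a x y; exact: (@scalerDr k A). Qed.

Lemma twist_scaleDl x : {morph twist_scale^~ x : a b / a + b}.
Proof. by move=> a b; rewrite /twist_scale rmorphD; exact: (@scalerDl k A). Qed.

HB.instance Definition _ := GRing.Zmodule_isLmodule.Build k Am
  twist_scaleA twist_scale1 twist_scaleDr twist_scaleDl.

Lemma twist_scaleAl (a : k) (x y : Am) : a *: (x * y) = (a *: x) * y.
Proof. exact: (@scalerAl k A). Qed.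

Lemma twist_scaleAr (a : k) (x y : Am) : a *: (x * y) = x * (a *: y).
Proof. exact: (@scalerAr k A). Qed.

HB.instance Definition _ := GRing.Lmodule_isLalgebra.Build k Am twist_scaleAl.
HB.instance Definition _ := GRing.Lalgebra_isAlgebra.Build k Am twist_scaleAr.

End Twist.

(* A relation, since in general no twist need be equivalent to A.           *)
Definition is_morita_frobenius_number (A : algType k) (m : nat) : Prop :=
  [/\ (0 < m)%N, morita_equivalent A (frobenius_twist pchark m A)
    & forall m' : nat, (0 < m')%N ->
        morita_equivalent A (frobenius_twist pchark m' A) -> (m <= m')%N].

End FrobeniusTwist.

(* Main.v *)
(**
Write x = alpha and y = beta gamma. In characteristic 2 the element
z = x y + y x is central in e0 A e0 and z^s = 0; over k[z]/(z^s) the corner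
e0 A e0 is free on e0, x, y, x y, with
  x^2 = z^(s-1) (y + c x y),   y^2 = z^(s-1) x y,   y x = z + x y,
a kind of quaternion algebra. A Morita equivalence between A and its twist
restricts to an isomorphism between e0 A e0 and a corner q A q of the twist
with q an idempotent of e0 A e0 or of e1 A e1; as e1 A e1 is commutative,
e0 A e0 is not, and the idempotents of e0 A e0 are trivial, q = e0. Comparing
coordinates of the images of x and y, whose components along x and y have
residues u and w, gives
  u^2 = (u w)^(s-1) w,   w^2 = (u w)^s,   c u^2 = c^2 (u w)^s.
If c is nonzero, rescaling alpha by u and beta by w is then an isomorphism
from the algebra with parameter c to the one with parameter 1. Conversely, a
parameter fixed by the Frobenius gives a semilinear ring automorphism.
*)
Require Import Defs.
From HB Require Import structures.
From mathcomp Require Import all_boot all_order all_algebra.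
From mathcomp Require Import boolp ring qpoly.
From mathcomp Require Import finmap monalg.

Set Implicit Arguments.
Unset Strict Implicit.
Unset Printing Implicit Defensive.

Import GRing.Theory.
Local Open Scope ring_scope.

(** * Universal properties *)

(** The comparison map goes from the twist to the algebra: the images x', y' of x and y satisfy the
    relations with parameter c^2, while their coordinates multiply with parameter c. The obstacle is
    the power (x'y' + y'x')^(s-1) of an unknown element. In characteristic 2 the anticommutator is a
    commutator, so the e0-coordinates drop out and it equals z h, where the coordinates of h are the
    2 by 2 minors of the remaining ones. Modulo z the corner is the commutative algebra k[x,y]/(x^2,
    y^2), in which h^2 is the square of the constant term of h. Since s = 2r + 2 is even, z^(s-1)
    h^(s-1) is therefore a scalar multiple of z^(s-1) h. The bound n >= 4 gives r > 0, which
    separates the coefficients of order at most 1 in z from those of order s - 1. No roots have to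
    be extracted in k: u and w come out of the comparison with exactly the equations that make the
    rescaling work. Relations only bound the corner from above; its freeness over k[z]/(z^s) comes
    from an explicit module, A e0 written in matrices. *)

Section PathAlgebraLift.
Variables (k : fieldType) (Q : quiver) (R : nzRingType) (sigma : {rmorphism k -> R}).
Hypothesis sigmaC : forall c r, sigma c * r = r * sigma c.
Variables (fv : qvertex Q -> R) (fa : qarrow Q -> R).
Hypothesis fvv : forall v w, fv v * fv w = if v == w then fv v else 0.
Hypothesis fv1 : \sum_v fv v = 1.
Hypothesis fva : forall a, fv (qsrc a) * fa a = fa a.
Hypothesis fav : forall a, fa a * fv (qtgt a) = fa a.

Local Notation kQ := (path_algebra k Q).

(** The leading vertex gives trivial paths their value; in longer paths [fva] absorbs it. *)
Definition path_value (p : qpath Q) : R :=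
  fv (path_start p) * \prod_(a <- path_arrows p) fa a.

(** With the end vertex exposed, orthogonality of the [fv] kills the products of non-composable
    paths. *)
Lemma path_value_end p : path_value p * fv (path_end p) = path_value p.
Proof.
rewrite /path_value /path_end /path_start /path_arrows.
case: p => -[v l] /= wl; elim: l v wl => [|a l IH] v /=.
  by rewrite big_nil mulr1 /walk_end /= fvv eqxx.
case/andP=> /eqP <- wl; rewrite big_cons /walk_end /= -/(walk_end _ _).
by rewrite -(fav a) -!mulrA [fv (qtgt a) * (_ * _)]mulrA IH.
Qed.

Lemma path_value_comp p q :
  path_value p * path_value q =
  if path_comp p q is Some r then path_value r else 0.
Proof.
case: path_compP => [r e rE|/negbTE ne].
  rewrite {2}/path_value mulrA -e path_value_end /path_value.
  by rewrite /path_start /path_arrows rE /= big_cat /= mulrA.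
rewrite -path_value_end {2}/path_value -!mulrA (mulrA (fv (path_end p))) fvv ne.
by rewrite mul0r !mulr0.
Qed.

Definition path_lift (x : kQ) : R :=
  \sum_(p <- msupp x) sigma (x@_p) * path_value p.

Lemma path_liftw (d : {fset qpath Q}) (x : kQ) : (msupp x `<=` d)%fset ->
  path_lift x = \sum_(p <- d) sigma (x@_p) * path_value p.
Proof.
move=> le; rewrite /path_lift (big_fset_incl _ le) //= => p _ /mcoeff_outdom ->.
by rewrite rmorph0 mul0r.
Qed.

Lemma path_liftD : {morph path_lift : x y / x + y}.
Proof.
move=> x y; rewrite (path_liftw (msuppD_le _ _)).
rewrite (path_liftw (fsubsetUl (msupp x) (msupp y))).
rewrite (path_liftw (fsubsetUr (msupp x) (msupp y))) -big_split /=.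
by apply: eq_bigr => p _; rewrite mcoeffD rmorphD mulrDl.
Qed.

Lemma path_lift_elt c p : path_lift (path_elt c p) = sigma c * path_value p.
Proof.
by rewrite path_eltE (path_liftw msuppU_le) big_seq_fset1 mcoeffUU.
Qed.

Lemma path_lift0 : path_lift 0 = 0.
Proof. by rewrite /path_lift msupp0 big_seq_fset0. Qed.

Lemma path_lift_zmod_morphism : zmod_morphism path_lift.
Proof.
have H : {morph path_lift : x / - x}.
  by move=> x; apply: (addIr (path_lift x)); rewrite -path_liftD !addNr path_lift0.
by move=> x y; rewrite path_liftD H.
Qed.

Lemma path_lift_monoid_morphism : monoid_morphism path_lift.
Proof.
split.
  rewrite -[1]/(pa_one k Q) /pa_one (big_morph _ path_liftD path_lift0) -fv1.
  apply: eq_bigr => v _; rewrite path_lift_elt rmorph1 mul1r /path_value.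
  by rewrite big_nil mulr1.
move=> x y; rewrite -[x * y]/(pa_mul x y).
elim/path_algebra_ind: x => [|x x' IH IH'|c p].
- by rewrite pa_mul0l path_lift0 mul0r.
- by rewrite pa_mulDl !path_liftD IH IH' mulrDl.
elim/path_algebra_ind: y => [|y y' IH IH'|d q].
- by rewrite pa_mul0r path_lift0 mulr0.
- by rewrite pa_mulDr !path_liftD IH IH' mulrDr.
rewrite pa_mulUU !path_lift_elt -mulrA [path_value p * _]mulrA -sigmaC.
rewrite -mulrA path_value_comp mulrA -rmorphM.
by case: path_comp => [r|] /=; rewrite ?path_lift_elt // path_lift0 mulr0.
Qed.

Lemma path_lift_vertex v : path_lift (vertex_elt k v) = fv v.
Proof. by rewrite path_lift_elt rmorph1 mul1r /path_value big_nil mulr1. Qed.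

Lemma path_lift_arrow a : path_lift (arrow_elt k a) = fa a.
Proof. by rewrite path_lift_elt rmorph1 mul1r /path_value big_seq1 fva. Qed.

Lemma path_liftZ c x : path_lift (c *: x) = sigma c * path_lift x.
Proof.
elim/path_algebra_ind: x => [|x x' IH IH'|d p].
- by rewrite scaler0 path_lift0 mulr0.
- by rewrite scalerDr !path_liftD IH IH' mulrDr.
have -> : c *: path_elt d p = path_elt (c * d) p.
  by have := opath_eltZ c d (Some p).
by rewrite !path_lift_elt rmorphM mulrA.
Qed.

Lemma path_lift_morphism : exists f : {rmorphism kQ -> R},
  [/\ forall v, f (vertex_elt k v) = fv v, forall a, f (arrow_elt k a) = fa a
    & forall c x, f (c *: x) = sigma c * f x].
Proof.
pose hm1 := GRing.isZmodMorphism.Build _ _ path_lift path_lift_zmod_morphism.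
pose hm2 := GRing.isMonoidMorphism.Build _ _ path_lift path_lift_monoid_morphism.
pose f : {rmorphism kQ -> R} := HB.pack path_lift hm1 hm2.
exists f; split; [exact: path_lift_vertex|exact: path_lift_arrow|exact: path_liftZ].
Qed.

End PathAlgebraLift.

Lemma quotient_lift (k : fieldType) (A : algType k) (I : proper_two_sided_ideal A)
    (R : nzRingType) (f : {rmorphism A -> R}) :
  (forall x, I x -> f x = 0) ->
  exists h : {rmorphism quotient_algebra I -> R},
    forall x, h (quotient_proj I x) = f x.
Proof.
move=> fI; pose h (u : quotient_algebra I) := f (quotient_repr u).
have hE x : h (quotient_proj I x) = f x.
  by apply/subr0_eq; rewrite -rmorphB fI //; exact: quotient_reprE.
have hB : zmod_morphism h.
  move=> u v; rewrite -[u]quotient_reprK -[v]quotient_reprK.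
  have -> : quotient_proj I (quotient_repr u) - quotient_proj I (quotient_repr v) =
            quotient_proj I (quotient_repr u - quotient_repr v).
    by apply: (addIr (quotient_proj I (quotient_repr v)));
      rewrite -quotient_projD !subrK.
  by rewrite !hE rmorphB.
have hM : monoid_morphism h.
  split=> [|u v]; first by rewrite -[1]/(quotient_proj I 1) hE rmorph1.
  rewrite -[u]quotient_reprK -[v]quotient_reprK.
  rewrite -[_ * _]/(quotient_mul _ _) -quotient_projM.
  by rewrite !hE rmorphM.
pose hm1 := GRing.isZmodMorphism.Build _ _ h hB.
pose hm2 := GRing.isMonoidMorphism.Build _ _ h hM.
pose H : {rmorphism quotient_algebra I -> R} := HB.pack h hm1 hm2.
by exists H.
Qed.

(** The presentation read in an arbitrary ring. The parameter is an element of [R] because a lift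
    sends the scalar c to [sigma c]. *)
Record Q2A_system (R : nzRingType) (s : nat) (c e0 e1 a b g : R) : Prop := {
  sys_e00 : e0 * e0 = e0; sys_e01 : e0 * e1 = 0;
  sys_e10 : e1 * e0 = 0; sys_e11 : e1 * e1 = e1; sys_e1 : e0 + e1 = 1;
  sys_e0a : e0 * a = a; sys_ae0 : a * e0 = a;
  sys_e0b : e0 * b = b; sys_be1 : b * e1 = b;
  sys_e1g : e1 * g = g; sys_ge0 : g * e0 = g;
  sys_gbg : g * b * g = (g * a * b) ^+ s.-1 * (g * a);
  sys_bgb : b * g * b = (a * b * g) ^+ s.-1 * (a * b);
  sys_aa : a ^+ 2 = (b * g * a) ^+ s.-1 * (b * g)
                    + c * ((b * g * a) ^+ s.-1 * (b * g * a));
  sys_aab : a ^+ 2 * b = 0 }.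

Section Q2AGenerators.
Variables (k : fieldType) (s : nat) (c : k).
Local Notation A := (Q2A s c).
Local Notation I := (ProperTwoSidedIdeal
  (ideal_generatedP (@Q2A_relation k s c)) (@Q2A_proper k s c)).

Definition Q2A_vertex (v : vertex2A) : A :=
  quotient_proj I (vertex_elt k (v : qvertex quiver2A)).
Definition Q2A_arrow (a : arrow2A) : A :=
  quotient_proj I (arrow_elt k (a : qarrow quiver2A)).

Local Notation pr := (quotient_proj I).

Lemma Q2A_projM x y : pr (x * y) = pr x * pr y.
Proof. exact: quotient_projM. Qed.
Lemma Q2A_projD x y : pr (x + y) = pr x + pr y.
Proof. exact: quotient_projD. Qed.
Lemma Q2A_projZ d x : pr (d *: x) = d *: pr x.
Proof. exact: quotient_projZ. Qed.
Lemma Q2A_rel x y : Q2A_relation s c (x - y) -> pr x = pr y.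
Proof.
by move=> H; apply/quotient_proj_eq => J iJ; apply.
Qed.

(** Paths are peeled from the left. Spanning sets only have to be stable under left multiplication
    by the three arrows, and maps only have to be compared on generators. *)
Lemma Q2A_ind (P : A -> Prop) :
  P 0 -> (forall u v, P u -> P v -> P (u + v)) -> (forall d u, P u -> P (d *: u)) ->
  (forall v, P (Q2A_vertex v)) -> (forall a u, P u -> P (Q2A_arrow a * u)) ->
  forall u, P u.
Proof.
move=> P0 PD PZ Pv Pa; elim/quotient_ind.
elim/path_algebra_ind => [|x y Px Py|d p].
- by rewrite quotient_proj0.
- by rewrite Q2A_projD; apply: PD.
have -> : path_elt d p = d *: path_elt 1 p.
  by have /= := opath_eltZ d 1 (Some p); rewrite mulr1 => <-.
rewrite Q2A_projZ; apply: PZ; case: p => -[v l] /= wl.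
elim: l v wl => [|a l IH] v wl.
  have -> : @QPath quiver2A (v, [::]) wl = trivial_path v by apply: val_inj.
  exact: Pv.
have /andP[/eqP av wl'] := wl.
have -> : path_elt 1 (@QPath quiver2A (v, a :: l) wl) =
   arrow_elt k a * path_elt (1 : k) (@QPath quiver2A (qtgt a, l) wl').
  rewrite -[RHS]/(pa_mul _ _) /arrow_elt pa_mulUU mulr1.
  have e : path_end (arrow_path a) = path_start (@QPath quiver2A (qtgt a, l) wl').
    by [].
  rewrite (path_compE e) /=; congr path_elt; apply: val_inj => /=.
  by move: av; rewrite /path_start /= => ->.
by rewrite Q2A_projM; apply: Pa.
Qed.

Lemma vertex_eltM (v w : vertex2A) :
  vertex_elt k (v : qvertex quiver2A) * vertex_elt k (w : qvertex quiver2A) =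
  if v == w then vertex_elt k (v : qvertex quiver2A) else 0.
Proof.
rewrite -[LHS]/(pa_mul _ _) /vertex_elt pa_mulUU mulr1 path_comp1p.
by rewrite /path_start /=; case: eqP => [->|].
Qed.

Lemma vertex_arrow_elt (a : arrow2A) :
  vertex_elt k (qsrc (a : qarrow quiver2A)) * arrow_elt k (a : qarrow quiver2A) =
  arrow_elt k (a : qarrow quiver2A).
Proof.
rewrite -[LHS]/(pa_mul _ _) /vertex_elt /arrow_elt pa_mulUU mulr1 path_comp1p.
by rewrite /path_start /= eqxx.
Qed.

Lemma arrow_vertex_elt (a : arrow2A) :
  arrow_elt k (a : qarrow quiver2A) * vertex_elt k (qtgt (a : qarrow quiver2A)) =
  arrow_elt k (a : qarrow quiver2A).
Proof.
rewrite -[LHS]/(pa_mul _ _) /vertex_elt /arrow_elt pa_mulUU mulr1 path_compp1.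
by rewrite /path_end /= eqxx.
Qed.

Lemma Q2A_proj_lrmorphism : exists f : {lrmorphism path_algebra k quiver2A -> A},
  forall x, f x = pr x.
Proof.
have hB : zmod_morphism pr.
  by move=> x y; apply: (addIr (pr y)); rewrite -Q2A_projD !subrK.
have hM : monoid_morphism pr by split=> // x y; rewrite Q2A_projM.
have hZ : scalable pr by move=> d x; rewrite Q2A_projZ.
pose m1 := GRing.isZmodMorphism.Build _ _ pr hB.
pose m2 := GRing.isMonoidMorphism.Build _ _ pr hM.
pose m3 := GRing.isScalable.Build _ _ _ _ pr hZ.
pose f : {lrmorphism path_algebra k quiver2A -> A} := HB.pack pr m1 m2 m3.
by exists f.
Qed.

Lemma Q2A_generators_system : Q2A_system s c%:A
  (Q2A_vertex V0) (Q2A_vertex V1) (Q2A_arrow Alpha) (Q2A_arrow Beta) (Q2A_arrow Gamma).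
Proof.
have [f fE] := Q2A_proj_lrmorphism.
have fR x y : Q2A_relation s c (x - y) -> f x = f y.
  by rewrite !fE; exact: Q2A_rel.
have vM := vertex_eltM; have va := vertex_arrow_elt; have av := arrow_vertex_elt.
rewrite /Q2A_vertex /Q2A_arrow -!fE; clear fE.
split; last 4 first.
- by rewrite -!rmorphM -rmorphXn -rmorphM; apply/fR/Q2A_gbg.
- by rewrite -!rmorphM -rmorphXn -rmorphM; apply/fR/Q2A_bgb.
- rewrite mulr_algl -!rmorphM -!rmorphXn -!rmorphM -linearZ -rmorphD.
  exact/fR/Q2A_aa.
- rewrite -rmorphXn -rmorphM -(rmorph0 f); apply: fR; rewrite subr0.
  exact: Q2A_aab.
- by rewrite -rmorphM vM.
- by rewrite -rmorphM vM rmorph0.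
- by rewrite -rmorphM vM rmorph0.
- by rewrite -rmorphM vM.
- rewrite -rmorphD -(rmorph1 f); congr (f _).
  rewrite -[RHS]/(pa_one k quiver2A) /pa_one /vertex_elt (bigD1 (V0 : vertex2A)) //=.
  by rewrite (bigD1 (V1 : vertex2A)) //= big1 ?addr0 //; case.
- by rewrite -rmorphM (va Alpha).
- by rewrite -rmorphM (av Alpha).
- by rewrite -rmorphM (va Beta).
- by rewrite -rmorphM (av Beta).
- by rewrite -rmorphM (va Gamma).
- by rewrite -rmorphM (av Gamma).
Qed.

Section Lift.
Variables (R : nzRingType) (sigma : {rmorphism k -> R}).
Hypothesis sigmaC : forall d r, sigma d * r = r * sigma d.

(** [R] carries a central ring map [sigma] instead of a k-algebra structure, so that one statement
    yields algebra maps, Frobenius-semilinear maps and the representation by matrices over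
    k[z]/(z^s). *)
Lemma Q2A_lift (e0 e1 a b g : R) : Q2A_system s (sigma c) e0 e1 a b g ->
  exists f : {rmorphism A -> R},
   [/\ forall d u, f (d *: u) = sigma d * f u,
       forall v, f (Q2A_vertex v) = if v is V0 then e0 else e1
     & forall x, f (Q2A_arrow x) =
         match x with Alpha => a | Beta => b | Gamma => g end].
Proof.
move=> S; pose fv (v : qvertex quiver2A) := if v is V0 then e0 else e1.
pose fa (x : qarrow quiver2A) := match x with Alpha => a | Beta => b | Gamma => g end.
have fvv v w : fv v * fv w = if v == w then fv v else 0.
  by case: v; case: w; case: S.
have fv1 : \sum_v fv v = 1.
  rewrite (bigD1 (V0 : vertex2A)) //= (bigD1 (V1 : vertex2A)) //= big1 ?addr0.
    by case: S.
  by case.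
have fva x : fv (qsrc x) * fa x = fa x by case: x; case: S.
have fav x : fa x * fv (qtgt x) = fa x by case: x; case: S.
have [L [Lv La LZ]] := path_lift_morphism sigmaC fvv fv1 fva fav.
have [|f fE] := @quotient_lift k _ I R L.
  move=> x /(_ (fun x => L x = 0)); apply.
    split=> [|x1 y1 Lx Ly|y1 x1 Lx]; rewrite ?rmorph0 ?rmorphD ?rmorphM ?Lx ?Ly ?addr0 //.
    by rewrite mulr0 mul0r.
  move=> _ []; rewrite ?rmorphB ?rmorphD ?LZ ?(rmorphM, rmorphXn) ?La /=;
    apply/eqP; rewrite ?subr_eq0; apply/eqP; case: S => //.
exists f; split=> [d|v|x]; last first.
- exact: (eq_trans (fE (arrow_elt k (x : qarrow quiver2A))) (La x)).
- exact: (eq_trans (fE (vertex_elt k (v : qvertex quiver2A))) (Lv v)).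
by elim/quotient_ind => x; rewrite -Q2A_projZ !fE LZ.
Qed.

End Lift.
End Q2AGenerators.

(** * Morita equivalences *)

Definition restricted_scalars (R S : nzRingType) (g : {rmorphism S -> R})
  (M : lmodType R) : Type := M.

Section RestrictedScalars.
Variables (R S : nzRingType) (g : {rmorphism S -> R}) (M : lmodType R).
Local Notation gM := (restricted_scalars g M).

HB.instance Definition _ := GRing.Zmodule.on gM.

Definition restricted_scale (c : S) (x : gM) : gM := g c *: (x : M).

Lemma restricted_scaleA a b x :
  restricted_scale a (restricted_scale b x) = restricted_scale (a * b) x.
Proof. by rewrite /restricted_scale scalerA rmorphM. Qed.

Lemma restricted_scale1 : left_id 1 restricted_scale.
Proof. by move=> x; rewrite /restricted_scale rmorph1 scale1r. Qed.

Lemma restricted_scaleDr : right_distributive restricted_scale +%R.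
Proof. by move=> a x y; exact: (@scalerDr R M). Qed.

Lemma restricted_scaleDl x : {morph restricted_scale^~ x : a b / a + b}.
Proof. by move=> a b; rewrite /restricted_scale rmorphD; exact: (@scalerDl R M). Qed.

HB.instance Definition _ := GRing.Zmodule_isLmodule.Build S gM
  restricted_scaleA restricted_scale1 restricted_scaleDr restricted_scaleDl.

End RestrictedScalars.

Section RestrictionFunctor.
Variables (R S : nzRingType) (g : {rmorphism S -> R}).

Definition restricted_fun (M N : lmodType R) (f : M -> N) :
  restricted_scalars g M -> restricted_scalars g N := f.

Lemma restricted_fun_linear (M N : lmodType R) (f : {linear M -> N}) :
  linear (restricted_fun f).
Proof. by move=> a x y; exact: (linearP f (g a) x y). Qed.

HB.instance Definition _ (M N : lmodType R) (f : {linear M -> N}) :=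
  GRing.isLinear.Build S (restricted_scalars g M) (restricted_scalars g N) _
    (restricted_fun f) (restricted_fun_linear f).

Definition restriction_functor : module_functor R S.
Proof.
by refine (@ModuleFunctor R S (fun M => restricted_scalars g M)
  (fun M N f => restricted_fun f) _ _ _).
Defined.

End RestrictionFunctor.

(** The unit is the identity map: after both restrictions [a] acts as [g (h a)]. *)
Lemma restriction_quasi_inverse (R S : nzRingType) (g : {rmorphism S -> R})
  (h : {rmorphism R -> S}) : (forall x, g (h x) = x) ->
  quasi_inverse (restriction_functor g) (restriction_functor h).
Proof.
move=> gh; have L (M : lmodType R) : linear
    (id : M -> restricted_scalars h (restricted_scalars g M)).
  move=> a x y.
  by rewrite -[a *: (x : restricted_scalars h (restricted_scalars g M))]/(g (h a) *: (x : M)) gh.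
pose eta (M : lmodType R) : {linear M -> restricted_scalars h (restricted_scalars g M)} :=
  HB.pack (id : M -> restricted_scalars h (restricted_scalars g M))
   (GRing.isLinear.Build _ _ _ _ _ (L M)).
by exists eta => // M; exists id.
Qed.

Lemma restriction_k_linear (k : fieldType) (A B : algType k) (g : {lrmorphism B -> A}) :
  k_linear_functor (restriction_functor (g : {rmorphism B -> A})
    : module_functor A B).
Proof.
split=> // M N c f h hE m; rewrite -[LHS]/(h m) hE.
by rewrite -[RHS]/(g c%:A *: f m) linearZ rmorph1.
Qed.

Lemma morita_equivalent_isomorphic (k : fieldType) (A B : algType k)
    (f : {lrmorphism A -> B}) (g : {lrmorphism B -> A}) :
  cancel f g -> cancel g f -> morita_equivalent A B.
Proof.
move=> fK gK.
exists (restriction_functor (g : {rmorphism B -> A})).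
exists (restriction_functor (f : {rmorphism A -> B})).
split; try exact: restriction_k_linear; exact: restriction_quasi_inverse.
Qed.

Section FunctorFacts.
Variables (k : fieldType) (A B : algType k).
Variables (F : module_functor A B) (G : module_functor B A).

Lemma quasi_inverse_faithful (M N : lmodType A) (f g : {linear M -> N}) :
  quasi_inverse F G -> fmap F f =1 fmap F g -> f =1 g.
Proof.
move=> [eta eta_bij etaN] fg m; apply: (bij_inj (eta_bij N)).
by rewrite !etaN; apply: fmap_ext.
Qed.

Lemma k_linear_functor0 (M N : lmodType A) (f : {linear M -> N}) :
  k_linear_functor F -> (forall m, f m = 0) -> forall m, fmap F f m = 0.
Proof.
move=> [_ FZ] f0 m; have H n : f n = (0 : k)%:A *: f n.
  by rewrite f0 scaler0.
by rewrite (FZ _ _ _ _ _ H) !scale0r.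
Qed.

End FunctorFacts.

Lemma linear_of (R : nzRingType) (M N : lmodType R) (f : M -> N) :
  linear f -> exists g : {linear M -> N}, g =1 f.
Proof.
move=> fL; pose g : {linear M -> N} := HB.pack f (GRing.isLinear.Build _ _ _ _ _ fL).
by exists g.
Qed.

(** * The corner attached to a Morita equivalence *)

Section MoritaCorner.
Variables (k : fieldType) (A B : algType k).
Variables (F : module_functor A B) (G : module_functor B A).
Hypothesis G_lin : k_linear_functor G.
Hypotheses (FG : quasi_inverse F G) (GF : quasi_inverse G F).

Lemma rmul_linear (b : B) : linear (fun r : B^o => (r * b : B^o)).
Proof. by move=> a x y; rewrite mulrDl -mulrA. Qed.

(** Right multiplications are the endomorphisms of the left module B. Carried through G they turn G
    B into a bimodule, with [T b v] in the role of v b; hence the reversed order in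
    [morita_actM]. *)
Definition rmul (b : B) : {linear B^o -> B^o} :=
  HB.pack (fun r : B^o => (r * b : B^o)) (GRing.isLinear.Build _ _ _ _ _ (rmul_linear b)).

Local Notation M := (G B^o).
Local Notation T b := (fmap G (rmul b)).

Lemma morita_act1 v : T 1 v = v.
Proof.
by rewrite -[RHS](@fmap_id _ _ G B^o v); apply: fmap_ext => x; exact: mulr1.
Qed.

Lemma morita_actM b b' v : T (b * b') v = T b' (T b v).
Proof.
rewrite -[RHS](@fmap_comp _ _ G _ _ _ (rmul b') (rmul b) v).
by apply: fmap_ext => x; exact: mulrA.
Qed.

Lemma morita_actD b b' v : T (b + b') v = T b v + T b' v.
Proof. by case: G_lin => GD _; apply: GD => x; exact: mulrDr. Qed.

Lemma morita_actZ c b v : T (c *: b) v = c%:A *: T b v.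
Proof.
case: G_lin => _ GZ; apply: GZ => x.
by rewrite -[LHS]/(x * (c *: b)) -scalerAr -[RHS]/(c%:A * (x * b)) mulr_algl.
Qed.

Lemma morita_act_inj b b' : T b =1 T b' -> b = b'.
Proof.
move/(quasi_inverse_faithful GF)/(_ (1 : B)).
by rewrite -[LHS]/(1 * b) -[RHS]/(1 * b') !mul1r.
Qed.

(** Conjugating F f by the isomorphism of B with F (G B) gives an endomorphism of the left module B,
    which is right multiplication by its value at 1. *)
Lemma morita_act_full (f : {linear M -> M}) : exists b, f =1 T b.
Proof.
have [eps eps_bij epsN] := GF.
have [epsi K1 K2] := eps_bij B^o.
have gL : linear (fun r : B^o => epsi (fmap F f (eps B^o r))).
  move=> a x y; rewrite linearP linearP; apply: (can_inj K1).
  by rewrite K2 linearP !K2.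
have [g gE] := linear_of gL.
exists (g (1 : B)); apply: (quasi_inverse_faithful FG) => w.
have gr r : g r = rmul (g (1 : B)) r.
  rewrite -[RHS]/(r *: g (1 : B)) -linearZ; congr (g _).
  by rewrite -[RHS]/(r * 1) mulr1.
by rewrite -[w]K2 -epsN -gr gE K2.
Qed.

(* [G B] is a generator: a map out of [A] killed by every [G B -> A] is zero. *)
Lemma morita_generator (S : lmodType A) (p : {linear A^o -> S}) :
  (forall (f : {linear M -> A^o}) v, p (f v) = 0) -> forall a, p a = 0.
Proof.
move=> pf0; have [eta eta_bij etaN] := FG.
have [etai K1 K2] := eta_bij A^o.
suff Fp0 y : fmap F p y = 0.
  move=> a; apply: (bij_inj (eta_bij S)); rewrite linear0 etaN.
  exact: (k_linear_functor0 G_lin Fp0).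
have gL : linear (fun b : B^o => (b : B) *: y).
  by move=> a u v; rewrite scalerDl -scalerA.
have [g gE] := linear_of gL.
(* Faithfulness of G reduces this to G (F p) composed with G g. By naturality of [eta] that
   composite is p after a map f from G B to A, and [pf0] kills it. *)
have zero0 b : (fmap F p \o g : {linear B^o -> F S}) b = 0.
  have zL : linear (fun _ : B^o => 0 : F S) by move=> ? ? ?; rewrite scaler0 addr0.
  have [z zE] := linear_of zL.
  rewrite -(zE b); move: b; apply: (quasi_inverse_faithful GF) => v.
  rewrite (k_linear_functor0 G_lin zE) (@fmap_comp _ _ G) /=.
  have fL : linear (fun v : M => etai (fmap G g v)).
    move=> a x x'; rewrite linearP; apply: (can_inj K1).
    by rewrite K2 linearP !K2.
  have [f fE] := linear_of fL.
  by rewrite -[fmap G g v]K2 -fE -etaN pf0 linear0.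
by have := zero0 (1 : B); rewrite /= gE scale1r.
Qed.

(* By [morita_generator] applied to the simple module k of the augmentation,
   some f : G B -> A and m in f_j (G B) have aug (f m) <> 0. As e0 A e0 is
   local, m generates a summand of G B isomorphic to A e0; the corresponding
   endomorphism of G B is right multiplication by an idempotent q, and theta
   is the action of B on the generator. *)
Lemma morita_corner (e0 : A) (aug : {rmorphism A -> k}) (f0 f1 : B) :
  e0 * e0 = e0 -> aug e0 = 1 ->
  (forall u, e0 * u = u -> u * e0 = u -> aug u != 0 ->
     exists u', [/\ e0 * u' = u', u' * e0 = u' & u * u' = e0]) ->
  f0 * f0 = f0 -> f1 * f1 = f1 -> f0 + f1 = 1 ->
  exists f q (theta : B -> A),
    [/\ f = f0 \/ f = f1, [/\ q * q = q, f * q = q, q * f = q & q != 0],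
       [/\ forall b b', theta (b + b') = theta b + theta b',
           forall c b, theta (c *: b) = c *: theta b,
           forall b b', b * q = b -> theta (b * b') = theta b * theta b',
           theta q = e0 & forall b, e0 * theta b = theta b /\ theta b * e0 = theta b],
       forall b, q * b = b -> b * q = b -> theta b = 0 -> b = 0
     & forall a, e0 * a = a -> a * e0 = a ->
         exists b, [/\ q * b = b, b * q = b & theta b = a]].
Proof.
move=> e00 auge loc f00 f11 f01.
have pL : linear (fun a : A^o => (aug a : restricted_scalars aug k^o)).
  by move=> a x y; rewrite rmorphD rmorphM.
have [p pE] := linear_of pL.
have [f [v fv]] : exists (f : {linear M -> A^o}) v, aug (f v) != 0.
  apply: contrapT => H.
  have /eqP : p (1 : A) = 0.
    apply: morita_generator => f v; rewrite pE; apply/eqP; apply: contrapT => /negP fv.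
    by apply: H; exists f, v.
  by rewrite pE rmorph1 oner_eq0.
have [j [jE jj]] : exists j, (j = f0 \/ j = f1) /\ aug (f (T j v)) != 0.
  have [Z|NZ] := eqVneq (aug (f (T f0 v))) 0; last by exists f0; split; [left|].
  exists f1; split; first by right.
  apply: contraNneq fv => Z1.
  by rewrite -[v]morita_act1 -f01 morita_actD linearD rmorphD Z Z1 addr0.
have jid : j * j = j by case: jE => ->.
pose m0 : M := e0 *: T j v.
pose u := e0 * f (T j v) * e0.
have [||| u' [eu' ue' uu']] := loc u.
- by rewrite /u !mulrA e00.
- by rewrite /u -!mulrA e00.
- by rewrite /u !rmorphM auge mul1r mulr1.
have em0 : e0 *: m0 = m0 by rewrite scalerA e00.
have psiL : linear (fun w : M => (f w * u' : A^o)).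
  by move=> a x y; rewrite linearP mulrDl -mulrA.
have [psi psiE] := linear_of psiL.
have psim : psi m0 = e0.
  have fm0 : f m0 = e0 * f (T j v) by exact: linearZ.
  by rewrite psiE fm0 -eu' mulrA -/u uu'.
have psie w : psi w * e0 = psi w by rewrite psiE -mulrA ue'.
have psiZ a w : psi (a *: w) = a * psi w by exact: linearZ.
have Tm0 : T j m0 = m0 by rewrite /m0 linearZ -morita_actM jid.
(* For a = e0 this is the projection onto A m0, and general a makes theta surjective onto e0 A e0.
   The inner [T j] is what forces j q = q. *)
have tauL a : linear (fun w => (psi (T j w) * a) *: m0).
  move=> d x y; have -> : psi (T j (d *: x + y)) = d * psi (T j x) + psi (T j y).
    by rewrite linearP; exact: linearP.
  by rewrite mulrDl scalerDl -mulrA -scalerA.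
have full a : exists b, forall w, T b w = (psi (T j w) * a) *: m0.
  have [t tE] := linear_of (tauL a); have [b tb] := morita_act_full t.
  by exists b => w; rewrite -tE tb.
have [q Tq] := full e0.
have Tj w : T j (T j w) = T j w by rewrite -morita_actM jid.
have Tqm : T q m0 = m0 by rewrite Tq Tm0 psim e00 em0.
have Tqw w : T q w = psi (T j w) *: m0 by rewrite Tq -scalerA em0.
(* For b in B q the element m0 b stays in A m0, so it is theta(b) m0. Acting by b' then gives m0 (b
   b') = theta(b) (m0 b'), which is why theta is multiplicative only for left factors in B q. *)
have bqm b : b * q = b -> T b m0 = psi (T b m0) *: m0.
  move=> E; have {1}-> : T b m0 = T q (T j (T b m0)).
    by rewrite Tqw Tj -Tqw -morita_actM E.
  rewrite Tqw Tj; congr (_ *: _).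
  have -> : T b m0 = T q (T b m0) by rewrite -morita_actM E.
  by rewrite Tqw linearZ Tm0.
exists j, q, (fun b => psi (T b m0)); split=> //.
- split.
  + apply: morita_act_inj => w.
    by rewrite morita_actM [T q w]Tqw linearZ Tqm.
  + apply: morita_act_inj => w.
    by rewrite morita_actM !Tqw Tj.
  + apply: morita_act_inj => w.
    by rewrite morita_actM [T q w]Tqw linearZ Tm0.
  apply/eqP => q0; move: (Tqm); rewrite q0 -(scale0r 0) morita_actZ scale0r scale0r.
  move=> m00; move: psim; rewrite -m00 linear0 => e00'.
  by move: auge; rewrite -e00' rmorph0 => /esym/eqP; rewrite oner_eq0.
- split=> [b b'|c b|b b' E||b].
  + by rewrite morita_actD linearD.
  + by rewrite morita_actZ psiZ mulr_algl.
  + by rewrite morita_actM (bqm _ E) linearZ psiZ -(bqm _ E).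
  + by rewrite Tqm.
  split; last exact: psie.
  by rewrite -psiZ -linearZ em0.
- move=> b qb bq b0; apply: morita_act_inj => w.
  have Tb0 : T b m0 = 0 by rewrite (bqm _ bq) b0 scale0r.
  have -> : T b w = 0 by rewrite -qb morita_actM Tqw linearZ /= Tb0 scaler0.
  by rewrite -(scale0r (0 : B)) morita_actZ scale0r scale0r.
move=> a ea ae; have [b Tb] := full a; exists b; split.
- apply: morita_act_inj => w.
  by rewrite morita_actM Tb Tb Tqw linearZ Tm0 psiZ psim psie.
- apply: morita_act_inj => w.
  by rewrite morita_actM Tb linearZ Tqm.
by rewrite Tb Tm0 psim ea psiZ psim ae.
Qed.

End MoritaCorner.
Lemma addvv_pchar2 (k : fieldType) (V : lmodType k) (v : V) :
  2%N \in [pchar k] -> v + v = 0.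
Proof. by move=> char2; rewrite -mulr2n -scaler_nat (pcharf0 char2) scale0r. Qed.

(** * The corner at the vertex 0 *)

(* The multiplication table of e A e on the k[z]-basis e, x, y, x y, in
   characteristic 2. *)
Record quad_basis (k : fieldType) (A : algType k) (s : nat) (c : k) (e x y z : A)
    : Prop := {
  quad_ee : e * e = e; quad_ex : e * x = x; quad_xe : x * e = x;
  quad_ey : e * y = y; quad_ye : y * e = y; quad_ez : e * z = z; quad_ze : z * e = z;
  quad_xz : x * z = z * x; quad_yz : y * z = z * y; quad_zs : z ^+ s = 0;
  quad_xx : x * x = z ^+ s.-1 * y + c *: (z ^+ s.-1 * (x * y));
  quad_yy : y * y = z ^+ s.-1 * (x * y); quad_yx : y * x = z + x * y;
  quad_xxy : x * x * y = 0; quad_xyy : x * y * y = 0 }.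

Section LocalRelations.
Variables (k : fieldType) (A : algType k) (s : nat) (c : k) (e x y : A).
Hypothesis char2 : 2%N \in [pchar k].
Hypothesis s_ge3 : (2 < s)%N.
Hypotheses (ee : e * e = e) (ex : e * x = x) (xe : x * e = x).
Hypotheses (ey : e * y = y) (ye : y * e = y).
Hypothesis xx : x * x = (y * x) ^+ s.-1 * y + c *: ((y * x) ^+ s.-1 * (y * x)).
Hypothesis yy : y * y = (x * y) ^+ s.
Hypothesis yxs : (y * x) ^+ s = (x * y) ^+ s.
Hypothesis xxy : x * x * y = 0.

Lemma local_xyy : x * y * y = 0.
Proof.
rewrite -mulrA yy; case: s s_ge3 => // t _.
by rewrite exprS !mulrA xxy mul0r.
Qed.

Lemma local_yyx_exp : y * y * x = (y * x) ^+ s.-1 * (y * x * x).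
Proof. by rewrite yy -yxs -{1}(ltn_predK s_ge3) exprSr -!mulrA. Qed.

(** Substituting x^2 leaves multiples of y (yx)^(s-1). As s >= 3 these begin with yyxy, and yyxy
    vanishes because it can be rewritten to end in xxy. *)
Lemma local_yxx : y * x * x = 0.
Proof.
have E2 : y * y * x * y = 0.
  by rewrite local_yyx_exp -!mulrA [x * (x * y)]mulrA xxy !mulr0.
have E3 w : y * ((y * x) ^+ s.-1 * w) = 0.
  by case: s s_ge3 => [|[|[|t]]] // _; rewrite /= !exprS !mulrA E2 !mul0r.
by rewrite -mulrA xx mulrDr -scalerAr !E3 scaler0 addr0.
Qed.

Lemma local_yyx : y * y * x = 0.
Proof. by rewrite local_yyx_exp local_yxx mulr0. Qed.

Definition local_z := x * y + y * x.
Local Notation z := local_z.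
Local Notation m := (x * y).

Lemma local_xz : x * z = z * x.
Proof. by rewrite mulrDr mulrDl !mulrA xxy local_yxx add0r addr0. Qed.

Lemma local_yz : y * z = z * y.
Proof.
by rewrite mulrDr mulrDl !mulrA local_xyy local_yyx add0r addr0.
Qed.

Lemma local_ez : e * z = z.
Proof. by rewrite mulrDr !mulrA ex ey. Qed.

Lemma local_ze : z * e = z.
Proof. by rewrite mulrDl -!mulrA xe ye. Qed.

(** Both mixed products of xy and yx vanish, by xyy = 0 and yxx = 0, so powers of the sum are taken
    termwise. *)
Lemma local_zX n : z ^+ n.+1 = m ^+ n.+1 + (y * x) ^+ n.+1.
Proof.
elim: n => [|n IH]; first by rewrite !expr1.
rewrite exprS IH mulrDl !mulrDr -!exprS.
have -> : m * (y * x) ^+ n.+1 = 0 by rewrite exprS !mulrA local_xyy !mul0r.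
have -> : y * x * m ^+ n.+1 = 0 by rewrite exprS !mulrA local_yxx !mul0r.
by rewrite addr0 add0r.
Qed.

Lemma local_zs : z ^+ s = 0.
Proof.
by rewrite -(ltn_predK s_ge3) local_zX (ltn_predK s_ge3) yxs (addvv_pchar2 _ char2).
Qed.

Lemma local_zs_y : z ^+ s.-1 * y = (y * x) ^+ s.-1 * y.
Proof.
case: s s_ge3 => [|[|t]] // _; rewrite /= local_zX mulrDl.
by rewrite exprSr -!mulrA [x * (y * y)]mulrA local_xyy mulr0 add0r.
Qed.

Lemma local_zs_m : z ^+ s.-1 * m = m ^+ s.
Proof.
case: s s_ge3 => [|[|t]] // _; rewrite /= local_zX mulrDl.
by rewrite [(y * x) ^+ _]exprSr -!mulrA [y * (x * (x * y))]mulrA [y * x * _]mulrA local_yxx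
  mul0r mulr0 addr0 -exprSr.
Qed.

Lemma local_xxE : x * x = z ^+ s.-1 * y + c *: (z ^+ s.-1 * m).
Proof.
by rewrite local_zs_y local_zs_m xx -exprSr (ltn_predK s_ge3) yxs.
Qed.

Lemma local_yyE : y * y = z ^+ s.-1 * m.
Proof. by rewrite local_zs_m. Qed.

Lemma local_yxE : y * x = z + m.
Proof. by rewrite /local_z addrAC (addvv_pchar2 _ char2) add0r. Qed.

Lemma local_quad_basis : quad_basis s c e x y z.
Proof.
split=> //; first exact: local_ez; first exact: local_ze; first exact: local_xz.
- exact: local_yz.
- exact: local_zs.
- exact: local_xxE.
- exact: local_yyE.
- exact: local_yxE.
exact: local_xyy.
Qed.

End LocalRelations.

(** * Multiplication in coordinates over k[z]/(z^s) *)

Section QuadAlgebra.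
Variables (k : fieldType) (A : algType k) (s : nat) (c : k) (e x y z : A).
Hypothesis H : quad_basis s c e x y z.

Let ee := quad_ee H. Let ex := quad_ex H. Let xe := quad_xe H.
Let ey := quad_ey H. Let ye := quad_ye H. Let xxy := quad_xxy H.

Local Notation m := (x * y).

Lemma quad_ym : y * m = z * y.
Proof. by rewrite mulrA (quad_yx H) mulrDl (quad_xyy H) addr0. Qed.

(** Evaluation takes place in the whole algebra, where constants become multiples of 1 and not of
    [e]; hence the factor [e] in the first term of [quad_elt]. *)
Definition quad_Z (p : {poly k}) : A := horner_alg z p.
Local Notation Z := quad_Z.

(* Coordinates are polynomials in z, meaningful only modulo 'X^s. *)
Definition quad_elt (p0 p1 p2 p3 : {poly k}) : A :=
  Z p0 * e + Z p1 * x + Z p2 * y + Z p3 * m.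
Local Notation L := quad_elt.

Lemma quad_ZM p q : Z (p * q) = Z p * Z q.
Proof. exact: rmorphM. Qed.

Lemma quad_ZD p q : Z (p + q) = Z p + Z q.
Proof. exact: rmorphD. Qed.

Lemma quad_ZX : Z 'X = z.
Proof. exact: horner_algX. Qed.

Lemma quad_ZXn n : Z 'X^n = z ^+ n.
Proof. by rewrite -quad_ZX; exact: rmorphXn. Qed.

Lemma quad_ZC d : Z d%:P = d%:A.
Proof. exact: horner_algC. Qed.

Lemma quad_ZXs p : Z ('X^s * p) = 0.
Proof. by rewrite quad_ZM quad_ZXn (quad_zs H) mul0r. Qed.

Lemma quad_Z_comm w p : w * z = z * w -> w * Z p = Z p * w.
Proof.
move=> wz; elim/poly_ind: p => [|p d IH].
  by rewrite /Z !rmorph0 mulr0 mul0r.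
rewrite quad_ZD quad_ZM quad_ZX quad_ZC mulrDr mulrDl.
by rewrite mulrA IH -!mulrA wz mulr_algl mulr_algr.
Qed.

Lemma quad_Z0 : Z 0 = 0.
Proof. exact: rmorph0. Qed.

Lemma quad_zXZ n p : z ^+ n * Z p = Z p * z ^+ n.
Proof. by rewrite -quad_ZXn -!quad_ZM mulrC. Qed.

Lemma quad_eltD p0 p1 p2 p3 q0 q1 q2 q3 :
  L p0 p1 p2 p3 + L q0 q1 q2 q3 = L (p0 + q0) (p1 + q1) (p2 + q2) (p3 + q3).
Proof. by rewrite /L !quad_ZD !mulrDl [LHS](AC (4*4) ((1*5)*(2*6)*(3*7)*(4*8))). Qed.

Lemma quad_eltZ p q0 q1 q2 q3 :
  Z p * L q0 q1 q2 q3 = L (p * q0) (p * q1) (p * q2) (p * q3).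
Proof. by rewrite /L !quad_ZM !mulrDr !mulrA. Qed.

Lemma quad_e_elt q0 q1 q2 q3 : e * L q0 q1 q2 q3 = L q0 q1 q2 q3.
Proof.
rewrite /L !mulrDr !mulrA !quad_Z_comm ?(quad_ez H) ?(quad_ze H) //.
by rewrite -!mulrA ee ex ey [e * (x * y)]mulrA ex.
Qed.

Lemma quad_elt_e q0 q1 q2 q3 : L q0 q1 q2 q3 * e = L q0 q1 q2 q3.
Proof. by rewrite /L !mulrDl -!mulrA ee xe ye. Qed.

Lemma quad_x_elt q0 q1 q2 q3 : x * L q0 q1 q2 q3 =
  L 0 q0 ('X^(s.-1) * q1) (q2 + c *: ('X^(s.-1) * q1)).
Proof.
rewrite /L !mulrDr !mulrA !quad_Z_comm ?(quad_xz H) // -!mulrA.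
rewrite xe [x * (x * y)]mulrA xxy mulr0 addr0 (quad_xx H).
rewrite -mul_polyC !quad_ZD !quad_ZM !quad_ZXn quad_ZC quad_Z0 mul0r add0r.
rewrite !mulrDr !mulrDl mulr_algl -scalerAl -scalerAr !mulrA quad_zXZ.
by rewrite [LHS](AC (1*2*1) (1*2*(4*3))).
Qed.

Lemma quad_y_elt q0 q1 q2 q3 : y * L q0 q1 q2 q3 =
  L ('X * q1) 0 (q0 + 'X * q3) (q1 + 'X^(s.-1) * q2).
Proof.
rewrite /L !mulrDr !mulrA !quad_Z_comm ?(quad_yz H) // -!mulrA.
rewrite ye quad_ym (quad_yx H) (quad_yy H).
rewrite !quad_ZD !quad_ZM !quad_ZXn quad_ZX quad_Z0 mul0r addr0.
rewrite !mulrDr !mulrDl !mulrA quad_zXZ -!(quad_Z_comm _ (erefl (z * z))).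
have -> : z * Z q1 * e = z * Z q1 by rewrite quad_Z_comm // -mulrA (quad_ze H).
by rewrite [LHS](AC (1*2*1*1) (2*(1*5)*(3*4))).
Qed.

Lemma quad_m_elt q0 q1 q2 q3 : m * L q0 q1 q2 q3 =
  L 0 ('X * q1) 0 (q0 + 'X * q3).
Proof.
rewrite -mulrA quad_y_elt quad_x_elt.
by rewrite mulr0 scaler0 addr0.
Qed.

Lemma quad_eltM p0 p1 p2 p3 q0 q1 q2 q3 : L p0 p1 p2 p3 * L q0 q1 q2 q3 =
  L (p0 * q0 + 'X * p2 * q1)
    (p0 * q1 + p1 * q0 + 'X * p3 * q1)
    (p0 * q2 + p2 * q0 + 'X^(s.-1) * p1 * q1 + 'X * p2 * q3)
    (p0 * q3 + p3 * q0 + p1 * q2 + p2 * q1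
     + 'X^(s.-1) * (c *: (p1 * q1) + p2 * q2) + 'X * p3 * q3).
Proof.
rewrite {1}/L !mulrDl -!(mulrA (Z _)) quad_e_elt quad_x_elt quad_y_elt quad_m_elt.
by rewrite !quad_eltZ !quad_eltD -!mul_polyC; congr quad_elt; ring.
Qed.

End QuadAlgebra.
Lemma coef_lt_mulr (R : comNzRingType) (p q : {poly R}) n :
  (forall i, (i < n)%N -> q`_i = 0) -> forall i, (i < n)%N -> (p * q)`_i = 0.
Proof.
move=> q0 i lt_in; rewrite coefM big1 // => j _.
by rewrite q0 ?mulr0 // (leq_ltn_trans (leq_subr _ _)).
Qed.

(** A nonzero constant term makes p invertible as a power series; strong induction on the degree
    replaces the inverse. *)
Lemma coef_lt_divr (R : idomainType) (p q : {poly R}) n : p`_0 != 0 ->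
  (forall i, (i < n)%N -> (p * q)`_i = 0) -> forall i, (i < n)%N -> q`_i = 0.
Proof.
move=> p0 pq; elim/ltn_ind => i IH lt_in; have := pq i lt_in.
rewrite coefM big_ord_recl big1 ?addr0 => [/eqP|j _].
  by rewrite mulf_eq0 (negPf p0) subn0 => /eqP.
have lt_j : (i - lift ord0 j < i)%N.
  by rewrite ltn_subrL /= /bump /=; case: (i) j => [[]|].
by rewrite IH ?mulr0 // (ltn_trans lt_j).
Qed.

(** * Locality of the corner, and pairs of elements satisfying the relations *)

Section QuadGenerators.
Variables (k : fieldType) (A : algType k) (s : nat) (c : k) (e x y z : A).
Hypothesis char2 : 2%N \in [pchar k].
Hypothesis H : quad_basis s c e x y z.
Variable r : nat.
Hypothesis sE : s = (r.*2.+2)%N.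
Hypothesis r_gt0 : (0 < r)%N.
Local Notation L := (quad_elt e x y z).
Local Notation Z := (quad_Z z).

Let addpp2 (p : {poly k}) : p + p = 0 := addvv_pchar2 p char2.

(* Multiplication by z^(s-1) only sees the residues modulo z. *)
Lemma quad_top p0 p1 p2 p3 : Z 'X^(s.-1) * L p0 p1 p2 p3 =
  L (p0`_0 *: 'X^(s.-1)) (p1`_0 *: 'X^(s.-1)) (p2`_0 *: 'X^(s.-1)) (p3`_0 *: 'X^(s.-1)).
Proof.
have E p : Z ('X^(s.-1) * p) = Z (p`_0 *: 'X^(s.-1)).
  have [q ->] : exists q, p = (p`_0)%:P + 'X * q.
    by elim/poly_ind: p => [|q a _]; [exists 0 | exists q];
      rewrite ?coef0 ?mulr0 ?addr0 // coefD coefMX coefC /= add0r mulrC addrC.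
  rewrite coefD coefXM coefC /= addr0 mulrDr quad_ZD mulrA -exprSr prednK ?sE //.
  by rewrite -{2}sE (quad_ZXs H) addr0 mulrC mul_polyC.
by rewrite quad_eltZ /quad_elt !E.
Qed.

Lemma quad_sq p0 p1 p2 p3 : L p0 p1 p2 p3 * L p0 p1 p2 p3 =
  L (p0 * p0 + 'X * (p1 * p2)) ('X * (p1 * p3))
    ('X^(s.-1) * (p1 * p1) + 'X * (p2 * p3))
    ('X^(s.-1) * (c *: (p1 * p1) + p2 * p2) + 'X * (p3 * p3)).
Proof.
rewrite (quad_eltM H); congr quad_elt.
- by ring.
- by rewrite [p1 * p0]mulrC addpp2 add0r; ring.
- by rewrite [p2 * p0]mulrC addpp2 add0r; ring.
rewrite [p3 * p0]mulrC addpp2 add0r [p2 * p1]mulrC addpp2 add0r.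
by rewrite -!mul_polyC; ring.
Qed.

Let addff2 (u : k) : u + u = 0 := addrr_pchar2 char2 u.

Lemma coef0_X : ('X : {poly k})`_0 = 0.
Proof. by rewrite coefX. Qed.

Lemma coef0_Xs : ('X^(s.-1) : {poly k})`_0 = 0.
Proof. by rewrite coefXn sE. Qed.

(** After multiplication by z^(s-1) only residues modulo z count. There x and y commute and have
    square zero, so in characteristic 2 the square of a + b x + d y is a^2. *)
Lemma quad_top_h2 a b d P0 P1 P2 P3 :
  Z 'X^(s.-1) * (L a b d 0 * (L a b d 0 * L P0 P1 P2 P3)) =
  Z (a`_0 ^+ 2)%:P * (Z 'X^(s.-1) * L P0 P1 P2 P3).
Proof.
rewrite !(quad_eltM H) !quad_top quad_eltZ; congr quad_elt;
  rewrite !mul_polyC !scalerA; congr (_ *: _);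
  rewrite -!mulrA !(coefD, coef0M, coefZ, coef0_X, coef0_Xs, coef0, mul0r, mulr0,
    addr0, add0r) /=.
- by ring.
- rewrite [RHS](_ : _ = a`_0 ^+ 2 * P1`_0 + (a`_0 * b`_0 * P0`_0 + a`_0 * b`_0 * P0`_0));
    last by rewrite addff2 addr0; ring.
  by ring.
- rewrite [RHS](_ : _ = a`_0 ^+ 2 * P2`_0 + (a`_0 * d`_0 * P0`_0 + a`_0 * d`_0 * P0`_0));
    last by rewrite addff2 addr0; ring.
  by ring.
set t := a`_0 * b`_0 * P2`_0 + a`_0 * d`_0 * P1`_0 + b`_0 * d`_0 * P0`_0.
rewrite [RHS](_ : _ = a`_0 ^+ 2 * P3`_0 + (t + t)); last by rewrite addff2 addr0; ring.
by rewrite /t; ring.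
Qed.

Lemma quad_exp_closed a b d n P0 P1 P2 P3 :
  exists R0 R1 R2 R3, L a b d 0 ^+ n * L P0 P1 P2 P3 = L R0 R1 R2 R3.
Proof.
elim: n => [|n [R0 [R1 [R2 [R3 E]]]]]; first by rewrite expr0 mul1r; do 4 eexists.
by rewrite exprS -mulrA E (quad_eltM H); do 4 eexists.
Qed.

Lemma quad_top_exp a b d n P0 P1 P2 P3 :
  Z 'X^(s.-1) * (L a b d 0 ^+ n.*2 * L P0 P1 P2 P3) =
  Z (a`_0 ^+ n.*2)%:P * (Z 'X^(s.-1) * L P0 P1 P2 P3).
Proof.
elim: n => [|n IH]; first by rewrite !expr0 mul1r /quad_Z rmorph1 mul1r.
rewrite doubleS !exprS -!mulrA.
have [R0 [R1 [R2 [R3 E]]]] := quad_exp_closed a b d n.*2 P0 P1 P2 P3.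
rewrite E quad_top_h2 -E IH mulrA -quad_ZM -polyCM.
by congr (Z _%:P * _); rewrite expr2 mulrA.
Qed.

Lemma quad_elt_Z_comm p P0 P1 P2 P3 : L P0 P1 P2 P3 * Z p = Z p * L P0 P1 P2 P3.
Proof.
apply: quad_Z_comm; rewrite /quad_elt !mulrDl !mulrDr !(mulrA z) !(quad_Z_comm _ erefl).
rewrite -!mulrA (quad_yz H) !(mulrA x) (quad_xz H) -!mulrA.
by rewrite (quad_ez H) (quad_ze H).
Qed.

(** If the constant term vanishes, every coordinate of the square is divisible by z, and z^s = 0. *)
Lemma quad_nilpotent (p0 p1 p2 p3 : {poly k}) : p0`_0 = 0 -> L p0 p1 p2 p3 ^+ s.*2 = 0.
Proof.
move=> p00; have [p0' ->] : exists p0', p0 = 'X * p0'.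
  elim/poly_ind: p0 p00 => [|p d _]; first by exists 0; rewrite mulr0.
  by rewrite coefD coefMX coefC add0r => ->; exists p; rewrite polyC0 addr0 mulrC.
have [R0 [R1 [R2 [R3 E]]]] : exists R0 R1 R2 R3,
    L ('X * p0') p1 p2 p3 * L ('X * p0') p1 p2 p3 = Z 'X * L R0 R1 R2 R3.
  have sX : 'X^(s.-1) = 'X * 'X^(s.-2) :> {poly k} by rewrite sE -exprS.
  rewrite quad_sq sX; do 4 eexists; rewrite quad_eltZ.
  rewrite -!(mulrA 'X) -!(mulrDr 'X); reflexivity.
rewrite -mul2n exprM expr2 E exprMn_comm; last exact: (esym (quad_elt_Z_comm _ _ _ _ _)).
by rewrite quad_ZX (quad_zs H) mul0r.
Qed.

(** With t the constant term, n = e + u / t has constant term 1 + 1 = 0 and is nilpotent. The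
    geometric series inverts n - 1 in the whole algebra, and e (n - 1) = u / t; cutting the inverse
    by e on both sides puts it in the corner. *)
Lemma quad_unit (p0 p1 p2 p3 : {poly k}) : p0`_0 != 0 ->
  exists u', [/\ e * u' = u', u' * e = u' & L p0 p1 p2 p3 * u' = e].
Proof.
set t := p0`_0 => t0; set u := L p0 p1 p2 p3.
have [eu ue] : e * u = u /\ u * e = u.
  by split; [exact: quad_e_elt H _ _ _ _ | exact: quad_elt_e H _ _ _ _].
pose n := e + t^-1 *: u.
have n0 : n ^+ s.*2 = 0.
  have -> : n = L (1 + (t^-1)%:P * p0) ((t^-1)%:P * p1) ((t^-1)%:P * p2) ((t^-1)%:P * p3).
    have eL : e = L 1 0 0 0.
      by rewrite /quad_elt !quad_Z0 !(mul0r, addr0) [Z 1]rmorph1 mul1r.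
    by rewrite /n -mulr_algl -(quad_ZC z) /u quad_eltZ {1}eL quad_eltD !add0r.
  apply: quad_nilpotent; rewrite coefD coefC /= coefCM mulVf //; exact: addff2.
have opp2 (w : A) : - w = w by apply/esym/eqP; rewrite -addr_eq0 (addvv_pchar2 _ char2).
pose S := \sum_(i < s.*2) n ^+ i.
have nS : (n - 1) * S = 1 by rewrite -subrX1 n0 sub0r opp2.
have uS : t^-1 *: u * S = e.
  have <- : e * (n - 1) = t^-1 *: u.
    rewrite mulrBr mulr1 mulrDr (quad_ee H) -scalerAr eu opp2 addrAC.
    by rewrite (addvv_pchar2 _ char2) add0r.
  by rewrite -mulrA nS mulr1.
exists (t^-1 *: (e * S * e)); split.
- by rewrite -scalerAr !mulrA (quad_ee H).
- by rewrite -scalerAl -[e * S * e * e]mulrA (quad_ee H).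
by rewrite -scalerAr !mulrA ue !scalerAl uS (quad_ee H).
Qed.

Lemma quad_idempotent (p0 p1 p2 p3 : {poly k}) (q : A) : q = L p0 p1 p2 p3 ->
  q * q = q -> q = 0 \/ q = e.
Proof.
move=> qE qq; have [p00|p00] := eqVneq p0`_0 0.
  left; have qX n : q ^+ n.+1 = q.
    by elim: n => [|n IH]; rewrite ?expr1 // exprS IH.
  by rewrite -(qX s.*2.-1) prednK ?double_gt0 ?sE // -sE qE quad_nilpotent.
right; have [u' [_ _]] := quad_unit p1 p2 p3 p00; rewrite -qE => qu.
have qe : q * e = q by rewrite qE (quad_elt_e H).
by rewrite -qe -qu mulrA qq.
Qed.

Variables (p0 p1 p2 p3 q0 q1 q2 q3 : {poly k}).
Let x' := L p0 p1 p2 p3.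
Let y' := L q0 q1 q2 q3.
Let D12 := p1 * q2 + p2 * q1.
Let D13 := p1 * q3 + p3 * q1.
Let D23 := p2 * q3 + p3 * q2.
Let h := L D12 D13 D23 0.

(** In characteristic 2 this is a commutator, hence alternating in the coordinates and free of those
    along e. The commutators of the basis are [x, y] = z, [x, xy] = z x and [y, xy] = z y, so h has
    no coordinate along xy. *)
Lemma quad_anticommutator : x' * y' + y' * x' = Z 'X * h.
Proof.
rewrite !(quad_eltM H) quad_eltD quad_eltZ; congr quad_elt.
- rewrite [RHS](_ : _ = 'X * D12 + (p0 * q0 + p0 * q0)); last by rewrite addpp2 addr0.
  by rewrite /D12; ring.
- rewrite [RHS](_ : _ = 'X * D13 + (p0 * q1 + p0 * q1) + (p1 * q0 + p1 * q0)).
    by rewrite /D13; ring.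
  by rewrite !addpp2 !addr0.
- rewrite [RHS](_ : _ = 'X * D23 + (p0 * q2 + p0 * q2) + (p2 * q0 + p2 * q0)
       + ('X^(s.-1) * p1 * q1 + 'X^(s.-1) * p1 * q1)).
    by rewrite /D23; ring.
  by rewrite !addpp2 !addr0.
rewrite mulr0 -[RHS](addpp2 (p0 * q3 + p3 * q0 + p1 * q2 + p2 * q1
     + 'X^(s.-1) * (c *: (p1 * q1) + p2 * q2) + 'X * p3 * q3)).
by rewrite -!mul_polyC; ring.
Qed.

Lemma quad_anticommutator_exp P0 P1 P2 P3 :
  (x' * y' + y' * x') ^+ s.-1 * L P0 P1 P2 P3 =
  Z (D12`_0 ^+ r.*2)%:P * (Z 'X^(s.-1) * (h * L P0 P1 P2 P3)).
Proof.
have hX : h * Z 'X = Z 'X * h by exact: quad_elt_Z_comm.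
rewrite quad_anticommutator exprMn_comm; last by rewrite /GRing.comm hX.
have -> : Z 'X ^+ s.-1 = Z 'X^(s.-1) by rewrite quad_ZX quad_ZXn.
rewrite {2}sE /= exprSr -!mulrA.
rewrite [h * L _ _ _ _](quad_eltM H).
by rewrite quad_top_exp.
Qed.

Let delta := p1`_0 * q2`_0 + p2`_0 * q1`_0.

Lemma quad_anticommutator_top : p0`_0 = 0 -> q0`_0 = 0 ->
  (x' * y' + y' * x') ^+ s.-1 * (x' * y') = L 0 0 0 (delta ^+ s *: 'X^(s.-1)).
Proof.
move=> p00 q00; set w := _ ^+ s.-1; rewrite [x' * y'](quad_eltM H) {}/w.
rewrite quad_anticommutator_exp.
rewrite [h * _](quad_eltM H) quad_top quad_eltZ.
congr quad_elt; rewrite !mul_polyC !scalerA;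
  rewrite -!mulrA !(coefD, coef0M, coefZ, coef0_X, coef0_Xs, coef0, p00, q00,
    mul0r, mulr0, addr0, add0r, scale0r) //=.
by rewrite -expr2 -exprD addn2 -sE.
Qed.

Lemma quad_anticommutator_y : q0`_0 = 0 ->
  (x' * y' + y' * x') ^+ s.-1 * y' =
  L 0 ((delta ^+ s.-1 * q1`_0) *: 'X^(s.-1)) ((delta ^+ s.-1 * q2`_0) *: 'X^(s.-1)) 0.
Proof.
move=> q00; rewrite quad_anticommutator_exp.
rewrite [h * _](quad_eltM H) quad_top quad_eltZ.
have E : delta ^+ s.-1 = delta ^+ r.*2 * delta by rewrite {1}sE exprSr.
congr quad_elt; rewrite !mul_polyC !scalerA;
  rewrite -!mulrA !(coefD, coef0M, coefZ, coef0_X, coef0_Xs, coef0, q00,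
    mul0r, mulr0, addr0, add0r, scale0r) // ?E -?mulrA //.
(* The xy-coordinate D12 q3 + D13 q2 + D23 q1 is a 3 by 3 determinant with the row q repeated. *)
set t := p1`_0 * q2`_0 * q3`_0 + p2`_0 * q1`_0 * q3`_0 + p3`_0 * q1`_0 * q2`_0.
rewrite [X in (_ * X) *: _](_ : _ = t + t); last by rewrite /t; ring.
by rewrite addff2 mulr0 scale0r.
Qed.

Hypothesis indep : forall P0 P1 P2 P3, L P0 P1 P2 P3 = 0 ->
  forall i, (i < s)%N -> [/\ P0`_i = 0, P1`_i = 0, P2`_i = 0 & P3`_i = 0].

Lemma quad_elt_inj P0 P1 P2 P3 R0 R1 R2 R3 :
  L P0 P1 P2 P3 = L R0 R1 R2 R3 ->
  forall i, (i < s)%N -> [/\ P0`_i = R0`_i, P1`_i = R1`_i, P2`_i = R2`_i & P3`_i = R3`_i].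
Proof.
move=> E i lt_is; have : L P0 P1 P2 P3 + L R0 R1 R2 R3 = 0.
  by rewrite E (addvv_pchar2 _ char2).
rewrite quad_eltD => /indep/(_ i lt_is); rewrite !coefD.
have F (u v : k) : u + v = 0 -> u = v.
  by move=> uv; rewrite -[u]addr0 -(addff2 v) addrA uv add0r.
by case=> /F-> /F-> /F-> /F->.
Qed.

(* u and w are the residues of p1 and q2; the residues of p2 and q1 vanish.
   The characteristic 2 cancels all contributions of the other coordinates. *)
Lemma quad_generators d :
  x' * x' = (x' * y' + y' * x') ^+ s.-1 * y' +
            d *: ((x' * y' + y' * x') ^+ s.-1 * (x' * y')) ->
  y' * y' = (x' * y' + y' * x') ^+ s.-1 * (x' * y') ->
  (x' * y' + y' * x') ^+ s.-1 * (x' * y') != 0 ->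
  exists u w, [/\ u != 0, w != 0, u ^+ 2 = (u * w) ^+ s.-1 * w,
                 w ^+ 2 = (u * w) ^+ s & c * u ^+ 2 = d * (u * w) ^+ s].
Proof.
move=> Ex Ey nz.
(* The e-coordinate of a square is P0^2 + z P1 P2. If the square is a multiple of z^(s-1) with s - 1
   > 1, its coefficients of order 0 and 1 vanish. *)
have sqc0 P0 P1 P2 P3 R0 R1 R2 R3 : L P0 P1 P2 P3 * L P0 P1 P2 P3 =
    Z 'X^(s.-1) * L R0 R1 R2 R3 -> P0`_0 = 0 /\ P1`_0 * P2`_0 = 0.
  rewrite quad_sq quad_top => E; have I := quad_elt_inj E.
  have P00 : P0`_0 = 0.
    have [|+ _ _ _] := I 0; first by rewrite sE.
    rewrite coefD coef0M coefXM addr0 coefZ coef0_Xs mulr0 => /eqP.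
    by rewrite mulf_eq0 orbb => /eqP.
  split=> //; have [|+ _ _ _] := I 1%N; first by rewrite sE.
  have s1 : (1 == s.-1)%N = false by rewrite sE; case: (r) r_gt0.
  have -> : (P0 * P0 + 'X * (P1 * P2))`_1 = P1`_0 * P2`_0.
    rewrite coefD coefXM coefM !big_ord_recl big_ord0 /=.
    have -> : (1 - bump 0 0 = 0)%N by [].
    by rewrite P00 mul0r mulr0 !add0r coef0M.
  by rewrite coefZ coefXn s1 mulr0.
have hl P0 P1 P2 P3 : exists R0 R1 R2 R3,
    (x' * y' + y' * x') ^+ s.-1 * L P0 P1 P2 P3 = Z 'X^(s.-1) * L R0 R1 R2 R3.
  rewrite quad_anticommutator_exp [h * _](quad_eltM H) mulrA -quad_ZM mulrC.
  by rewrite quad_ZM -mulrA quad_eltZ; do 4 eexists.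
have dZ (u : k) w : u *: w = Z u%:P * w by rewrite quad_ZC mulr_algl.
have xyL : exists R0 R1 R2 R3, x' * y' = L R0 R1 R2 R3.
  by rewrite (quad_eltM H); do 4 eexists.
have [R0 [R1 [R2 [R3 xyE]]]] := xyL.
have [p00 a12] : p0`_0 = 0 /\ p1`_0 * p2`_0 = 0.
  have [S0 [S1 [S2 [S3 E1]]]] := hl q0 q1 q2 q3.
  have [T0 [T1 [T2 [T3 E2]]]] := hl R0 R1 R2 R3.
  move: Ex; rewrite {3}xyE E2 -/y' E1 dZ mulrA -quad_ZM mulrC quad_ZM -mulrA.
  by rewrite -mulrDr quad_eltZ quad_eltD; apply: sqc0.
have [q00 b12] : q0`_0 = 0 /\ q1`_0 * q2`_0 = 0.
  have [T0 [T1 [T2 [T3 E2]]]] := hl R0 R1 R2 R3.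
  by move: Ey; rewrite {2}xyE E2; apply: sqc0.
have Et := quad_anticommutator_top p00 q00; rewrite {}Et in Ex Ey nz.
have delta0 : delta != 0.
  apply: contraNneq nz => ->; rewrite expr0n sE /= scale0r.
  by rewrite /quad_elt quad_Z0 !mul0r !addr0.
rewrite quad_anticommutator_y // dZ quad_eltZ quad_eltD !mulr0 !addr0 add0r mul_polyC
  scalerA /x' quad_sq in Ex.
rewrite /y' quad_sq in Ey.
have Ix := quad_elt_inj Ex; have Iy := quad_elt_inj Ey; clear Ex Ey.
have s1 : (s.-1 < s)%N by rewrite sE.
have s11 : s.-1 = s.-2.+1 by rewrite sE.
have lts i : (i < s.-1)%N -> (i.+1 < s)%N by rewrite sE.
have cX P i : ('X * P : {poly k})`_i.+1 = P`_i by rewrite coefXM.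
have cX1 P : ('X * P : {poly k})`_(s.-1) = P`_(s.-2) by rewrite s11 cX.
have cT P i : (i < s)%N -> ('X^(s.-1) * P : {poly k})`_i = if i == s.-1 then P`_0 else 0.
  rewrite sE ltnS leq_eqVlt => /orP[/eqP->|lt_i].
    by rewrite coefXnM ltnn subnn eqxx.
  by rewrite coefXnM lt_i (ltn_eqF lt_i).
have cS (u : k) i : (u *: 'X^(s.-1))`_i = if i == s.-1 then u else 0.
  by rewrite coefZ coefXn; case: eqP; rewrite ?mulr1 ?mulr0.
have div0 (Q P : {poly k}) : Q`_0 != 0 -> (forall i, (i.+1 < s)%N -> (Q * P)`_i = 0) ->
    forall i, (i < s.-1)%N -> P`_i = 0.
  by move=> Q0 HQ; apply: (coef_lt_divr Q0) => i /lts; apply: HQ.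
have mul0 (Q P : {poly k}) : (forall i, (i < s.-1)%N -> P`_i = 0) -> (Q * P)`_(s.-2) = 0.
  by move=> HP; apply: (coef_lt_mulr _ HP); rewrite [X in (_ < X)%N]s11.
(* A vanishing p1(0) would swap x and y to first order, with q1(0) nonzero. The x-coordinate of y'^2
   then clears q3 below order s - 1, and q1(0)^2 survives in the y-coordinate of y'^2, which has to
   be 0. *)
have [p10|p10] := eqVneq p1`_0 0.
  have : p2`_0 * q1`_0 != 0 by move: delta0; rewrite /delta p10 mul0r add0r.
  rewrite mulf_eq0 negb_or => /andP[p20 q10]; exfalso.
  have q30 : forall i, (i < s.-1)%N -> q3`_i = 0.
    apply: (div0 _ _ q10) => i lt_i; have [_ + _ _] := Iy _ lt_i.
    by rewrite cX coef0.
  have [_ _ + _] := Iy _ s1; rewrite coefD cT // eqxx coef0M cX1 mul0 // coef0.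
  by rewrite addr0 => /eqP; rewrite mulf_eq0 (negPf q10).
have p20 : p2`_0 = 0 by move/eqP: a12; rewrite mulf_eq0 (negPf p10) => /eqP.
have deltaE : delta = p1`_0 * q2`_0 by rewrite /delta p20 mul0r addr0.
have q20 : q2`_0 != 0.
  by apply: contraNneq delta0 => q20; rewrite deltaE q20 mulr0.
have q10 : q1`_0 = 0 by move/eqP: b12; rewrite mulf_eq0 (negPf q20) orbF => /eqP.
(* In the coefficient of z^(s-1), the terms z p2 p3, z p3^2 and z q3^2 of the squares involve order
   s - 2 of products with p3 or q3. Clearing p3 and q3 below order s - 1 removes them and leaves
   only residues. *)
have p30 : forall i, (i < s.-1)%N -> p3`_i = 0.
  apply: (div0 _ _ p10) => i lt_i; have [_ + _ _] := Ix _ lt_i.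
  by rewrite cX q10 mulr0 scale0r coef0.
have q30 : forall i, (i < s.-1)%N -> q3`_i = 0.
  apply: (div0 _ _ q20) => i lt_i; have [_ _ + _] := Iy _ lt_i.
  by rewrite coefD cX cT // coef0M q10 mul0r if_same add0r coef0.
exists p1`_0, q2`_0; rewrite -deltaE; split=> //.
- have [_ _ + _] := Ix _ s1.
  by rewrite coefD cT // cS eqxx coef0M cX1 mul0 // addr0 expr2.
- have [_ _ _] := Iy _ s1.
  rewrite coefD cT // cS eqxx coefD coefZ !coef0M q10 mul0r mulr0 add0r.
  by rewrite cX1 mul0 // addr0 expr2.
have [_ _ _] := Ix _ s1.
rewrite coefD cT // cS eqxx coefD coefZ !coef0M p20 mul0r addr0.
by rewrite cX1 mul0 // addr0 expr2.
Qed.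

End QuadGenerators.
Lemma quad_Z_intertwine (k : fieldType) (A : algType k) (w u v : A) p :
  w * u = v * w -> w * quad_Z u p = quad_Z v p * w.
Proof.
move=> wz; elim/poly_ind: p => [|p d IH]; first by rewrite !quad_Z0 mulr0 mul0r.
rewrite !quad_ZD !quad_ZM !quad_ZX !quad_ZC mulrDr mulrDl.
by rewrite mulrA IH -!mulrA wz mulr_algl mulr_algr.
Qed.

Lemma quad_Z_kill (k : fieldType) (A : algType k) (w u : A) p :
  w * u = 0 -> w * quad_Z u p = p`_0 *: w.
Proof.
move=> wz; elim/poly_ind: p => [|p d IH]; first by rewrite quad_Z0 mulr0 coef0 scale0r.
rewrite quad_ZD quad_ZM quad_ZX quad_ZC mulrDr mulrA IH -scalerAl wz scaler0 add0r.
by rewrite mulr_algr coefD coefMX coefC add0r.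
Qed.

(** * Spanning sets of the corners *)

Section SystemCorner.
Variables (k : fieldType) (A : algType k) (s : nat) (c : k) (e0 e1 a b g : A).
Hypothesis char2 : 2%N \in [pchar k].
Hypothesis s_ge3 : (2 < s)%N.
Hypothesis S : Q2A_system s c%:A e0 e1 a b g.

Lemma sys_be0 : b * e0 = 0.
Proof. by rewrite -(sys_be1 S) -mulrA (sys_e10 S) mulr0. Qed.
Lemma sys_ge1 : g * e1 = 0.
Proof. by rewrite -(sys_ge0 S) -mulrA (sys_e01 S) mulr0. Qed.
Lemma sys_ae1 : a * e1 = 0.
Proof. by rewrite -(sys_ae0 S) -mulrA (sys_e01 S) mulr0. Qed.
Lemma sys_e0g : e0 * g = 0.
Proof. by rewrite -(sys_e1g S) mulrA (sys_e01 S) mul0r. Qed.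
Lemma sys_ag : a * g = 0.
Proof. by rewrite -(sys_ae0 S) -mulrA sys_e0g mulr0. Qed.
Lemma sys_gg : g * g = 0.
Proof. by rewrite -{1}(sys_ge0 S) -mulrA sys_e0g mulr0. Qed.
Lemma sys_aab' : a * a * b = 0.
Proof. by rewrite -expr2 (sys_aab S). Qed.

Lemma exp_bgab n : b * (g * a * b) ^+ n = (b * g * a) ^+ n * b.
Proof. by elim: n => [|n IH]; rewrite ?mul1r ?mulr1 // exprSr mulrA IH exprSr -!mulrA. Qed.

(** The element bgbg is evaluated in two ways: through bgb it is (abg)^s, through gbg it is (bga)^s.
    This gives both y^2 = (xy)^s and (xy)^s = (yx)^s. *)
Lemma sys_quad_basis : quad_basis s c e0 a (b * g) (local_z a (b * g)).
Proof.
have sE : s.-1.+1 = s by exact: ltn_predK s_ge3.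
apply: local_quad_basis => //; rewrite ?(sys_e00 S) ?(sys_e0a S) ?(sys_ae0 S) //.
- by rewrite mulrA (sys_e0b S).
- by rewrite -mulrA (sys_ge0 S).
- by rewrite -expr2 (sys_aa S) mulr_algl.
- by rewrite mulrA (sys_bgb S) -[in RHS]sE exprSr !mulrA.
- transitivity (b * g * (b * g)); last by rewrite mulrA (sys_bgb S) -[in RHS]sE exprSr !mulrA.
  by rewrite -[RHS]mulrA [g * _]mulrA (sys_gbg S) [RHS]mulrA exp_bgab -{1}sE exprSr !mulrA.
by rewrite mulrA sys_aab' mul0r.
Qed.

Local Notation L := (quad_elt e0 a (b * g) (local_z a (b * g))).
Local Notation z := (local_z a (b * g)).
Local Notation Z := (quad_Z z).

Lemma sys_corner_left (w : A) :
  (exists p0 p1 p2 p3 q0 q1 q2 q3, w = L p0 p1 p2 p3 + g * L q0 q1 q2 q3) ->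
  [/\ exists p0 p1 p2 p3 q0 q1 q2 q3, a * w = L p0 p1 p2 p3 + g * L q0 q1 q2 q3,
      exists p0 p1 p2 p3 q0 q1 q2 q3, b * w = L p0 p1 p2 p3 + g * L q0 q1 q2 q3
    & exists p0 p1 p2 p3 q0 q1 q2 q3, g * w = L p0 p1 p2 p3 + g * L q0 q1 q2 q3].
Proof.
case=> p0 [p1 [p2 [p3 [q0 [q1 [q2 [q3 ->]]]]]]].
have L0 : L 0 0 0 0 = 0 by rewrite /quad_elt quad_Z0 !mul0r !addr0.
have gL0 : g * L 0 0 0 0 = 0 by rewrite L0 mulr0.
have B := sys_quad_basis; split.
- do 4 eexists; exists 0, 0, 0, 0.
  by rewrite gL0 addr0 mulrDr (mulrA a g) sys_ag mul0r addr0 (quad_x_elt B).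
- do 4 eexists; exists 0, 0, 0, 0.
  rewrite gL0 addr0 mulrDr (mulrA b g) (quad_y_elt B) -{1}(quad_e_elt B).
  by rewrite mulrA sys_be0 mul0r add0r.
exists 0, 0, 0, 0; do 4 eexists.
by rewrite L0 add0r mulrDr (mulrA g g) sys_gg mul0r addr0.
Qed.

(** These elements span e1 A e1: polynomials in gab, plus multiples of gb, which annihilates gab on
    both sides. Commutativity needs spanning only, so no independence is claimed. *)
Definition corner1_elt (p : {poly k}) (d : k) : A :=
  e1 * quad_Z (g * a * b) p + d *: (g * b).

Local Notation Z1 := (quad_Z (g * a * b)).

Lemma sys_abgb : a * b * g * b = 0.
Proof.
rewrite -!mulrA [b * (g * b)]mulrA (sys_bgb S).
by case: s s_ge3 => [|[|t]] // _; rewrite /= exprS !mulrA sys_aab' !mul0r.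
Qed.

Lemma sys_gaa : g * a * a = 0.
Proof.
rewrite -mulrA -expr2 (sys_aa S) mulr_algl mulrDr -scalerAr.
have E w : g * ((b * g * a) ^+ s.-1 * (b * w)) = 0.
  rewrite [(b * g * a) ^+ _ * _]mulrA -exp_bgab.
  case: s s_ge3 (sys_gbg S) => [|[|t]] // _ /= gbg.
  rewrite exprS !mulrA gbg -!mulrA [a * (a * _)]mulrA [a * a * _]mulrA sys_aab'.
  by rewrite mul0r !mulr0.
have := E (g * a); rewrite [b * (g * a)]mulrA => E2.
by rewrite E E2 scaler0 addr0.
Qed.

(** The stray term gbga contains gaa = 0. So g carries z to gab, as b does in [sys_zb], and
    polynomials in z can be moved between the two corners. *)
Lemma sys_gz : g * z = g * a * b * g.
Proof.
rewrite mulrDr !mulrA (sys_gbg S); case: s s_ge3 => [|[|t]] // _.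
by rewrite exprSr -!mulrA [g * (a * a)]mulrA sys_gaa !mulr0 addr0.
Qed.

Lemma sys_zb : z * b = b * (g * a * b).
Proof. by rewrite mulrDl !mulrA sys_abgb add0r. Qed.

Lemma sys_gbz1 : g * b * (g * a * b) = 0.
Proof.
rewrite !mulrA (sys_gbg S) -!mulrA; case: s s_ge3 => [|[|t]] // _.
by rewrite [a * (a * b)]mulrA sys_aab' !mulr0.
Qed.

Lemma sys_z1gb : g * a * b * (g * b) = 0.
Proof.
rewrite -!mulrA !(mulrA a) -!mulrA [a * (b * _)]mulrA [a * b * _]mulrA.
by rewrite sys_abgb mulr0.
Qed.

Lemma sys_Z1_gb r : Z1 r * (g * b) = r`_0 *: (g * b).
Proof.
rewrite -(@quad_Z_intertwine _ _ (g * b) (g * a * b)); last first.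
  by rewrite sys_gbz1 sys_z1gb.
by rewrite quad_Z_kill ?sys_gbz1.
Qed.

Lemma corner1_elt_comm p d q d' :
  corner1_elt p d * corner1_elt q d' = corner1_elt q d' * corner1_elt p d.
Proof.
have e1z : e1 * (g * a * b) = g * a * b by rewrite !mulrA (sys_e1g S).
have ze1 : g * a * b * e1 = g * a * b by rewrite -mulrA (sys_be1 S).
have Ze r : e1 * Z1 r = Z1 r * e1 by apply: quad_Z_intertwine; rewrite e1z ze1.
have egb : e1 * (g * b) = g * b by rewrite mulrA (sys_e1g S).
have gbe : g * b * e1 = g * b by rewrite -mulrA (sys_be1 S).
have E r t r' t' : corner1_elt r t * corner1_elt r' t' =
    e1 * Z1 (r * r') + (r`_0 * t' + t * r'`_0) *: (g * b) + (t * t') *: (g * b * (g * b)).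
  rewrite /corner1_elt mulrDl !mulrDr -!scalerAl -!scalerAr.
  have -> : e1 * Z1 r * (e1 * Z1 r') = e1 * Z1 (r * r').
    by rewrite quad_ZM [RHS]mulrA -mulrA [Z1 r * (e1 * _)]mulrA -Ze !mulrA (sys_e11 S).
  have -> : e1 * Z1 r * (g * b) = r`_0 *: (g * b).
    by rewrite -mulrA sys_Z1_gb -scalerAr egb.
  have -> : g * b * (e1 * Z1 r') = r'`_0 *: (g * b).
    by rewrite mulrA gbe quad_Z_kill ?sys_gbz1.
  by rewrite !scalerA scalerDl !addrA [t' * _]mulrC.
by rewrite !E [q * p]mulrC [d' * d]mulrC; congr (_ + _ *: _ + _); ring.
Qed.

Lemma sys_corner1 (w : A) :
  (exists p d p0 p1 p2 p3, w = corner1_elt p d + L p0 p1 p2 p3 * b) ->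
  [/\ exists p d p0 p1 p2 p3, a * w = corner1_elt p d + L p0 p1 p2 p3 * b,
      exists p d p0 p1 p2 p3, b * w = corner1_elt p d + L p0 p1 p2 p3 * b
    & exists p d p0 p1 p2 p3, g * w = corner1_elt p d + L p0 p1 p2 p3 * b].
Proof.
case=> p [d [p0 [p1 [p2 [p3 ->]]]]].
have B := sys_quad_basis.
have L0 : L 0 0 0 0 * b = 0 by rewrite /quad_elt quad_Z0 !mul0r !addr0 mul0r.
have C0 : corner1_elt 0 0 = 0 by rewrite /corner1_elt quad_Z0 scale0r mulr0 addr0.
split.
- exists 0, 0; do 4 eexists; rewrite C0 add0r mulrDr.
  rewrite mulrDr -scalerAr !(mulrA a) sys_ae1 sys_ag !mul0r scaler0 !add0r.
  by rewrite (quad_x_elt B).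
- exists 0, 0, p, 0, d%:P, 0; rewrite C0 add0r mulrDr.
  have -> : b * (L p0 p1 p2 p3 * b) = 0.
    by rewrite -(quad_e_elt B) !mulrA sys_be0 !mul0r.
  rewrite addr0 mulrDr -scalerAr (mulrA b) (sys_be1 S).
  rewrite (quad_Z_intertwine _ (esym sys_zb)).
  rewrite /quad_elt !quad_Z0 !mul0r !addr0 quad_ZC mulr_algl mulrDl -scalerAl.
  by rewrite -mulrA (sys_e0b S) mulrA.
(* Moving g past the coefficients turns z into gab. The four terms become p0(gab) gb = p0(0) gb,
   p1(gab) gab, p2(gab) (gab)^s because gbgb = (gab)^s, and 0 because abgb = 0. *)
exists (p1 * 'X + p2 * 'X^s), (p0`_0), 0, 0, 0, 0.
rewrite L0 addr0 mulrDr.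
have -> : g * corner1_elt p d = 0.
  by rewrite mulrDr -scalerAr !(mulrA g) sys_ge1 sys_gg !mul0r scaler0 addr0.
rewrite add0r /quad_elt !mulrDl !mulrDr !(mulrA g) !(@quad_Z_intertwine _ _ g z _ _ sys_gz).
have -> : Z1 p0 * g * e0 * b = p0`_0 *: (g * b).
  by rewrite -(mulrA (Z1 p0)) (sys_ge0 S) -mulrA sys_Z1_gb.
have -> : Z1 p3 * g * (a * (b * g)) * b = 0.
  by rewrite -!mulrA [a * (b * _)]mulrA [a * b * _]mulrA sys_abgb !mulr0.
have -> : Z1 p2 * g * (b * g) * b = Z1 (p2 * 'X^s).
  rewrite quad_ZM quad_ZXn -!mulrA; congr (_ * _).
  by rewrite !mulrA (sys_gbg S) -[_ ^+ _ * _ * b]mulrA -exprSr (ltn_predK s_ge3).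
have -> : Z1 p1 * g * a * b = Z1 (p1 * 'X) by rewrite quad_ZM quad_ZX !mulrA.
have e1X r n : e1 * Z1 (r * 'X^(n.+1)) = Z1 (r * 'X^(n.+1)).
  rewrite mulrC quad_ZM quad_ZXn exprS !mulrA.
  by rewrite (sys_e1g S).
rewrite /corner1_elt quad_ZD mulrDr -['X]expr1 e1X -{2}(ltn_predK s_ge3) e1X.
by rewrite (ltn_predK s_ge3) addr0 [LHS](AC (2*1) (2*3*1)).
Qed.

Hypothesis gen : forall P : A -> Prop,
  P 0 -> (forall u v, P u -> P v -> P (u + v)) -> (forall d u, P u -> P (d *: u)) ->
  P e0 -> P e1 -> (forall u, P u -> [/\ P (a * u), P (b * u) & P (g * u)]) ->
  forall u, P u.

Lemma sys_corner0 u : e0 * u = u -> u * e0 = u -> exists p0 p1 p2 p3, u = L p0 p1 p2 p3.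
Proof.
have B := sys_quad_basis.
have span v : exists p0 p1 p2 p3 q0 q1 q2 q3,
    v * e0 = L p0 p1 p2 p3 + g * L q0 q1 q2 q3.
  elim/gen: v => [|v w|d v|||v].
  - exists 0, 0, 0, 0, 0, 0, 0, 0.
    by rewrite /quad_elt quad_Z0 !(mul0r, mulr0, addr0).
  - move=> [p0 [p1 [p2 [p3 [q0 [q1 [q2 [q3 E]]]]]]]].
    move=> [p0' [p1' [p2' [p3' [q0' [q1' [q2' [q3' E']]]]]]]].
    do 8 eexists; rewrite mulrDl E E' addrACA -mulrDr !quad_eltD; reflexivity.
  - move=> [p0 [p1 [p2 [p3 [q0 [q1 [q2 [q3 E]]]]]]]].
    have dZ w : d *: w = Z d%:P * w by rewrite quad_ZC mulr_algl.
    do 8 eexists; rewrite -scalerAl E scalerDr scalerAr !dZ !quad_eltZ; reflexivity.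
  - exists 1, 0, 0, 0, 0, 0, 0, 0; rewrite (sys_e00 S).
    by rewrite /quad_elt !quad_Z0 !(mul0r, mulr0, addr0) [Z 1]rmorph1 mul1r.
  - exists 0, 0, 0, 0, 0, 0, 0, 0; rewrite (sys_e10 S).
    by rewrite /quad_elt quad_Z0 !(mul0r, mulr0, addr0).
  by move=> /sys_corner_left; rewrite !mulrA.
move=> eu ue; have [p0 [p1 [p2 [p3 [q0 [q1 [q2 [q3 E]]]]]]]] := span u.
exists p0, p1, p2, p3; rewrite -eu -ue E mulrDr (quad_e_elt B).
by rewrite mulrA sys_e0g mul0r addr0.
Qed.

Lemma sys_corner1_comm u v : e1 * u = u -> u * e1 = u ->
  e1 * v = v -> v * e1 = v -> u * v = v * u.
Proof.
have B := sys_quad_basis.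
have span w : exists p d p0 p1 p2 p3, w * e1 = corner1_elt p d + L p0 p1 p2 p3 * b.
  elim/gen: w => [|v1 w1|d v1|||w].
  - exists 0, 0, 0, 0, 0, 0.
    by rewrite /quad_elt /corner1_elt !quad_Z0 !(mul0r, mulr0, addr0, scale0r).
  - move=> [p [d [p0 [p1 [p2 [p3 E]]]]]] [p' [d' [p0' [p1' [p2' [p3' E']]]]]].
    exists (p + p'), (d + d'), (p0 + p0'), (p1 + p1'), (p2 + p2'), (p3 + p3').
    rewrite mulrDl E E' addrACA -mulrDl !quad_eltD; congr (_ + _).
    by rewrite /corner1_elt quad_ZD mulrDr scalerDl addrACA.
  - move=> [p [d' [p0 [p1 [p2 [p3 E]]]]]].
    exists (d%:P * p), (d * d'), (d%:P * p0), (d%:P * p1), (d%:P * p2), (d%:P * p3).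
    rewrite -scalerAl E scalerDr scalerAl -quad_eltZ quad_ZC mulr_algl.
    congr (_ + _); rewrite /corner1_elt quad_ZM quad_ZC mulr_algl.
    by rewrite scalerDr scalerA -scalerAr.
  - exists 0, 0, 0, 0, 0, 0; rewrite (sys_e01 S).
    by rewrite /quad_elt /corner1_elt !quad_Z0 !(mul0r, mulr0, addr0, scale0r).
  - exists 1, 0, 0, 0, 0, 0; rewrite (sys_e11 S).
    rewrite /quad_elt /corner1_elt !quad_Z0 !(mul0r, mulr0, addr0, scale0r).
    by rewrite [Z1 1]rmorph1 mulr1.
  by move=> /sys_corner1; rewrite !mulrA.
have corner w : e1 * w = w -> w * e1 = w -> exists p d, w = corner1_elt p d.
  move=> ew we; have [p [d [p0 [p1 [p2 [p3 E]]]]]] := span w.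
  exists p, d; rewrite -ew -we E mulrDr -(quad_e_elt B) !mulrA (sys_e10 S) !mul0r addr0.
  by rewrite /corner1_elt mulrDr mulrA (sys_e11 S) -scalerAr mulrA (sys_e1g S).
move=> eu ue ev ve; have [p [d ->]] := corner u eu ue; have [q [d' ->]] := corner v ev ve.
exact: corner1_elt_comm.
Qed.

End SystemCorner.

(** * A faithful representation of the corner *)

Section Matrix6.
Variable R : comNzRingType.

(** Indices are plain numbers, so that the products of matrix units are decided by computation on
    numerals. *)
Definition unit6 (i j : nat) : 'M[R]_6 :=
  \matrix_(u < 6, v < 6) ((u == i :> nat) && (v == j :> nat))%:R.

Lemma unit6M i j k l : (j < 6)%N ->
  unit6 i j * unit6 k l = if j == k then unit6 i l else 0.
Proof.
move=> lt_j; apply/matrixP => u v; rewrite !mxE (bigD1 (Ordinal lt_j)) //= !mxE /= eqxx.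
rewrite andbT big1 ?addr0 => [|w nw].
  by case: (j == k); rewrite ?mxE /=; case: (u == i :> nat); case: (v == l :> nat);
    rewrite /= ?mulr0 ?mul0r ?mulr1.
rewrite !mxE (_ : (w == j :> nat) = false) ?andbF ?mul0r //.
by apply: contraNF nw => /eqP wj; apply/eqP/val_inj.
Qed.

Variables z t c : R.
Hypotheses (tz : t * z = 0) (tt : t * t = 0) (two : forall u : R, u + u = 0).
Local Notation E := unit6.

(* The left action of A on A e0 in the k[z]/(z^s)-basis
   e0, x, y, x y, gamma, gamma x, with t = z^(s-1); note that
   beta gamma x = y x = z + x y, which gives the last column of beta. *)
Definition rep_e0 := E 0 0 + E 1 1 + E 2 2 + E 3 3.
Definition rep_e1 := E 4 4 + E 5 5.
Definition rep_a := E 1 0 + t *: E 2 1 + (c * t) *: E 3 1 + E 3 2.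
Definition rep_b := E 2 4 + z *: E 0 5 + E 3 5.
Definition rep_g := E 4 0 + z *: E 4 3 + E 5 1 + t *: E 5 2.

Let simpE := (mul0r, mulr0, mulrDl, mulrDr, addr0, add0r, scaler0, scalerDr).
Ltac expand6 := rewrite ?simpE -?(scalerAl, scalerAr) !unit6M //= -?(scalerAl, scalerAr)
  ?simpE ?scalerA.

Lemma rep_zt : z * t = 0.
Proof. by rewrite mulrC. Qed.

Lemma rep_tz0 u : (t * (z * u) = 0) * (z * (t * u) = 0) * (t * (t * u) = 0)
   * (z * (u * t) = 0) * (t * (u * t) = 0) * (t * (u * z) = 0).
Proof.
by do ![split]; rewrite ?[u * t]mulrC ?[u * z]mulrC mulrA ?rep_zt ?tz ?tt mul0r.
Qed.

Lemma two6 (M : 'M[R]_6) : M + M = 0.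
Proof. by rewrite -[M]scale1r -scalerDl two scale0r. Qed.

Lemma rep_ga : rep_g * rep_a = z *: E 4 2 + E 5 0.
Proof.
rewrite /rep_g /rep_a; expand6.
by rewrite !rep_tz0 tt !scale0r addr0 add0r.
Qed.

Lemma rep_gb : rep_g * rep_b = t *: E 5 4.
Proof. by rewrite /rep_g /rep_b; expand6; rewrite two6 add0r. Qed.

Lemma rep_ab : rep_a * rep_b = E 3 4 + z *: E 1 5.
Proof. by rewrite /rep_a /rep_b; expand6; rewrite addrC. Qed.

Lemma rep_bg : rep_b * rep_g = E 2 0 + z *: E 2 3 + z *: E 0 1 + E 3 1 + t *: E 3 2.
Proof. by rewrite /rep_b /rep_g; expand6; rewrite rep_zt scale0r addr0 !addrA. Qed.

Lemma rep_bga : rep_b * rep_g * rep_a = z *: E 0 0 + z *: E 2 2 + E 3 0.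
Proof.
rewrite rep_bg /rep_a; expand6; rewrite !rep_tz0 tt !scale0r add0r addr0.
by rewrite [z *: E 2 2 + _]addrC.
Qed.

Lemma rep_abg : rep_a * (rep_b * rep_g) = E 3 0 + z *: E 3 3 + z *: E 1 1.
Proof. by rewrite mulrA rep_ab /rep_g; expand6; rewrite rep_zt scale0r addr0 ?addrA. Qed.

Lemma rep_z : rep_a * (rep_b * rep_g) + rep_b * rep_g * rep_a = z *: rep_e0.
Proof.
rewrite rep_abg rep_bga /rep_e0 !scalerDr [LHS](AC (3*3) ((4*3)*5*2*(1*6))).
by rewrite /= two6 addr0.
Qed.

(** Column 0 is the image of the generator e0 of A e0, and there the four coefficients stand in
    different rows. *)
Lemma rep_free u0 u1 u2 u3 :
  u0 *: rep_e0 + u1 *: rep_a + u2 *: (rep_b * rep_g) + u3 *: (rep_a * (rep_b * rep_g)) = 0 ->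
  [/\ u0 = 0, u1 = 0, u2 = 0 & u3 = 0].
Proof.
rewrite rep_abg rep_bg => /matrixP M0.
have := (M0 (@Ordinal 6 0 isT) ord0, M0 (@Ordinal 6 1 isT) ord0,
         M0 (@Ordinal 6 2 isT) ord0, M0 (@Ordinal 6 3 isT) ord0).
by rewrite !mxE /= !(mulr0, mulr1, addr0, add0r) => -[[[-> ->]]] -> ->.
Qed.

Lemma rep_gab : rep_g * rep_a * rep_b = z *: rep_e1.
Proof. by rewrite rep_ga /rep_b /rep_e1; expand6. Qed.

Lemma rep_gbg : rep_g * rep_b * rep_g = t *: (rep_g * rep_a).
Proof. by rewrite rep_gb rep_ga /rep_g; expand6; rewrite tz !scale0r addr0 add0r. Qed.

Lemma rep_bgb : rep_b * rep_g * rep_b = t *: (rep_a * rep_b).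
Proof.
by rewrite -mulrA rep_gb rep_ab /rep_b; expand6; rewrite tz rep_zt !scale0r addr0 add0r.
Qed.

Lemma rep_aa : rep_a * rep_a = t *: (rep_b * rep_g) + (c * t) *: (rep_b * rep_g * rep_a).
Proof.
rewrite rep_bga rep_bg /rep_a; expand6; rewrite ?(tt, tz) -?mulrA ?(tt, tz).
by rewrite !(mulr0, scale0r, addr0, add0r) addrAC.
Qed.

Lemma rep_aab : rep_a * rep_a * rep_b = 0.
Proof.
rewrite -mulrA rep_ab /rep_a; expand6; rewrite -mulrA tz mulr0 !scale0r.
exact: addr0.
Qed.

Lemma rep_system s : (2 < s)%N -> z ^+ s.-1 = t ->
  Q2A_system s (c%:M : 'M[R]_6) rep_e0 rep_e1 rep_a rep_b rep_g.
Proof.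
move=> s_ge3 zt.
have e1g : rep_e1 * rep_g = rep_g by rewrite /rep_e1 /rep_g; expand6; rewrite ?addrA.
have be1 : rep_b * rep_e1 = rep_b by rewrite /rep_e1 /rep_b; expand6; rewrite ?addrA.
(* Each of the three 3-cycles acts as z on the elements it meets in the relations, so its powers
   turn into scalars and the exponent s - 1 produces t. *)
have gabX n w : rep_e1 * w = w -> (rep_g * rep_a * rep_b) ^+ n * w = z ^+ n *: w.
  move=> ew; rewrite rep_gab; elim: n => [|n IH]; first by rewrite mul1r scale1r.
  by rewrite exprSr -mulrA -scalerAl ew -scalerAr IH scalerA -exprS.
have abgX n : (rep_a * rep_b * rep_g) ^+ n * (rep_a * rep_b) = z ^+ n *: (rep_a * rep_b).
  have E1 : rep_a * rep_b * rep_g * (rep_a * rep_b) = z *: (rep_a * rep_b).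
    by rewrite -mulrA (mulrA rep_g) rep_gab -scalerAr -mulrA be1.
  elim: n => [|n IH]; first by rewrite mul1r scale1r.
  by rewrite exprSr -mulrA E1 -scalerAr IH scalerA -exprS.
have bgaX n w : (rep_b * rep_g * rep_a) ^+ n * (rep_b * (rep_g * w)) =
    z ^+ n *: (rep_b * (rep_g * w)).
  have E1 : rep_b * rep_g * rep_a * (rep_b * (rep_g * w)) = z *: (rep_b * (rep_g * w)).
    rewrite -(mulrA rep_b) -mulrA (mulrA (rep_g * rep_a)) rep_gab.
    by rewrite mulrA -scalerAr be1 -scalerAl.
  elim: n => [|n IH]; first by rewrite mul1r scale1r.
  by rewrite exprSr -mulrA E1 -scalerAr IH scalerA -exprS.
split.
- by rewrite /rep_e0; expand6.
- by rewrite /rep_e0 /rep_e1; expand6.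
- by rewrite /rep_e0 /rep_e1; expand6.
- by rewrite /rep_e1; expand6.
- apply/matrixP => -[[|[|[|[|[|[|i]]]]]] // Hi] -[[|[|[|[|[|[|j]]]]]] // Hj];
    by rewrite !mxE /= ?addr0 ?add0r.
- by rewrite /rep_e0 /rep_a; expand6; rewrite ?addrA.
- by rewrite /rep_e0 /rep_a; expand6; rewrite ?addrA.
- by rewrite /rep_e0 /rep_b; expand6; rewrite ?addrA [X in X + _]addrC.
- exact: be1.
- exact: e1g.
- by rewrite /rep_e0 /rep_g; expand6; rewrite ?addrA.
- by rewrite rep_gbg gabX ?zt // mulrA e1g.
- by rewrite rep_bgb abgX zt.
- rewrite expr2 rep_aa.
  have := bgaX s.-1 1; rewrite mulr1 => ->.
  have := bgaX s.-1 rep_a; rewrite (mulrA rep_b) => ->.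
  by rewrite zt -[c%:M]scalemx1 -scalerAl mul1r scalerA.
by rewrite expr2 rep_aab.
Qed.
End Matrix6.
Lemma in_qpoly_Xn_eq0 (k : fieldType) s (p : {poly k}) : (0 < s)%N ->
  in_qpoly 'X^s p = 0 -> forall i, (i < s)%N -> p`_i = 0.
Proof.
move=> s_gt0 /(congr1 val) /=; rewrite mk_monic_Xn prednK // => p0 i lt_i.
by rewrite (Pdiv.RingMonic.rdivp_eq (monicXn k s) p) p0 addr0 coefMXn lt_i.
Qed.

Lemma quad_elt_image (k : fieldType) (A : algType k) (s : nat) (c : k) (e x y z : A)
    (R : comNzRingType) (M : algType R) (iota : {rmorphism {poly k} -> R})
    (f : {rmorphism A -> M}) p0 p1 p2 p3 :
  quad_basis s c e x y z -> (forall d, f d%:A = (iota d%:P)%:A) ->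
  f z * f e = iota 'X *: f e ->
  f (quad_elt e x y z p0 p1 p2 p3) =
    iota p0 *: f e + iota p1 *: f x + iota p2 *: f y + iota p3 *: f (x * y).
Proof.
move=> B fC fz.
have fZp p : f (quad_Z z p) * f e = iota p *: f e.
  elim/poly_ind: p => [|p d IH]; first by rewrite quad_Z0 rmorph0 mul0r rmorph0 scale0r.
  rewrite quad_ZD quad_ZM quad_ZX quad_ZC !rmorphD !rmorphM mulrDl -mulrA fz.
  by rewrite -scalerAr IH scalerA scalerDl mulrC fC mulr_algl.
have fw p w : e * w = w -> f (quad_Z z p * w) = iota p *: f w.
  by move=> ew; rewrite -{1}ew !rmorphM mulrA fZp -scalerAl -rmorphM ew.
have [ee ex ey] := And3 (quad_ee B) (quad_ex B) (quad_ey B).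
by rewrite /quad_elt !rmorphD !fw // mulrA ex.
Qed.

Lemma quad_elt_augmentation (k : fieldType) (A : algType k) (aug : {rmorphism A -> k})
    (e x y : A) p0 p1 p2 p3 :
  (forall d, aug d%:A = d) -> aug e = 1 -> aug x = 0 ->
  aug (quad_elt e x y (local_z x y) p0 p1 p2 p3) = p0`_0 + p2`_0 * aug y.
Proof.
move=> augC ae ax; have aZ p : aug (quad_Z (local_z x y) p) = p`_0.
  elim/poly_ind: p => [|p d IH]; first by rewrite quad_Z0 rmorph0 coef0.
  rewrite quad_ZD quad_ZM quad_ZX quad_ZC rmorphD rmorphM augC /local_z.
  rewrite rmorphD !rmorphM ax !(mul0r, mulr0, addr0).
  by rewrite coefD coefMX coefC /= ?add0r.
rewrite /quad_elt !rmorphD !rmorphM !aZ ae ax.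
by rewrite !(mul0r, mulr0, addr0, mulr1).
Qed.

(** * The two corners of Q(2A) *)

Section Q2ACorner.
Variables (k : fieldType) (s : nat) (c : k).
Hypothesis char2 : 2%N \in [pchar k].
Hypothesis s_ge3 : (2 < s)%N.
Local Notation A := (Q2A s c).
Local Notation e0 := (Q2A_vertex s c V0).
Local Notation e1 := (Q2A_vertex s c V1).
Local Notation a := (Q2A_arrow s c Alpha).
Local Notation b := (Q2A_arrow s c Beta).
Local Notation g := (Q2A_arrow s c Gamma).
Local Notation z := (local_z a (b * g)).
Local Notation L := (quad_elt e0 a (b * g) z).

Lemma Q2A_quad_basis : quad_basis s c e0 a (b * g) z.
Proof. exact: (sys_quad_basis char2 s_ge3 (Q2A_generators_system s c)). Qed.

(** Over k[X]/(X^s) the matrices satisfy the relations with z acting on the image of e0 as X, and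
    vanishing in that ring means vanishing of the first s coefficients. *)
Lemma Q2A_indep p0 p1 p2 p3 : L p0 p1 p2 p3 = 0 ->
  forall i, (i < s)%N -> [/\ p0`_i = 0, p1`_i = 0, p2`_i = 0 & p3`_i = 0].
Proof.
pose R0 := {poly %/ ('X^s : {poly k})}.
pose iota : {rmorphism {poly k} -> R0} := in_qpoly 'X^s.
pose sigma : {rmorphism k -> 'M[R0]_6} := scalar_mx \o (iota \o polyC).
have sigmaC d r : sigma d * r = r * sigma d by exact: comm_scalar_mx.
have sE : s.-1.+1 = s by exact: ltn_predK s_ge3.
pose zz := iota 'X; pose t := zz ^+ s.-1.
have zs : zz ^+ s = 0.
  rewrite -rmorphXn; apply: val_inj => /=.
  by rewrite mk_monic_Xn sE Pdiv.RingMonic.rmodpp ?monicXn.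
have tz : t * zz = 0 by rewrite -exprSr sE.
have tt : t * t = 0.
  rewrite -exprD -(subnKC (_ : s <= s.-1 + s.-1)%N) ?exprD ?zs ?mul0r //.
  by rewrite -{1}sE -addn1 leq_add2l -ltnS sE ltnW.
have two (u : R0) : u + u = 0.
  exact: addvv_pchar2.
have [f [fZ fv fa]] := Q2A_lift sigmaC (rep_system (iota c%:P) tz tt two s_ge3 erefl).
have fe : f e0 = rep_e0 R0 by rewrite fv.
have fbg : f (b * g) = rep_b zz * rep_g zz t by rewrite rmorphM !fa.
have fz : f z * f e0 = zz *: f e0.
  have -> : f z = f a * (f b * f g) + f b * f g * f a.
    by rewrite rmorphD [f (a * _)]rmorphM [f (_ * a)]rmorphM [f (b * g)]rmorphM.
  rewrite !fa rep_z // fe -scalerAl; congr (_ *: _).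
  exact: sys_e00 (rep_system (iota c%:P) tz tt two s_ge3 erefl).
have fC d : f d%:A = (iota d%:P)%:A.
  by rewrite fZ rmorph1 mulr1 -[sigma d]/((iota d%:P)%:M) -scalemx1.
move=> /(congr1 f); rewrite (quad_elt_image _ _ _ _ Q2A_quad_basis fC fz) rmorph0.
rewrite fe [f (a * _)]rmorphM fbg !fa => /(rep_free tz) [E0 E1 E2 E3] i lt_i.
have s0 : (0 < s)%N by rewrite -sE.
by split; apply: (in_qpoly_Xn_eq0 s0) lt_i.
Qed.

Lemma Q2A_gen (P : A -> Prop) :
  P 0 -> (forall u v, P u -> P v -> P (u + v)) -> (forall d u, P u -> P (d *: u)) ->
  P e0 -> P e1 -> (forall u, P u -> [/\ P (a * u), P (b * u) & P (g * u)]) ->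
  forall u, P u.
Proof.
move=> P0 PD PZ Pe0 Pe1 Pm; apply: Q2A_ind => // [[]//|x u /Pm[]].
by case: x.
Qed.

Lemma Q2A_xy_neq_yx : a * (b * g) != b * g * a.
Proof.
have S := Q2A_generators_system s c; have B := Q2A_quad_basis.
apply/eqP => E; have : L 'X 0 0 0 = 0.
  rewrite /quad_elt !quad_Z0 !mul0r !addr0 quad_ZX (quad_ze B) /local_z E.
  exact: addvv_pchar2.
by move/Q2A_indep/(_ 1%N (ltnW s_ge3)); rewrite coefX => -[/eqP]; rewrite oner_eq0.
Qed.

Lemma Q2A_augmentation : exists aug : {rmorphism A -> k},
  aug e0 = 1 /\ forall p0 p1 p2 p3, aug (L p0 p1 p2 p3) = p0`_0.
Proof.
have C d r : (idfun d : k) * r = r * idfun d by exact: mulrC.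
have S : Q2A_system s (idfun c) (1 : k) 0 0 0 0.
  by split; rewrite /= ?(mul0r, mulr0, mulr1, addr0, expr0n).
have [aug [augZ augv auga]] := Q2A_lift C S.
exists aug; split=> [|p0 p1 p2 p3]; first by rewrite augv.
rewrite quad_elt_augmentation ?augv ?auga //; last by move=> d; rewrite augZ rmorph1 mulr1.
by rewrite rmorphM !auga !mulr0 addr0.
Qed.

Lemma Q2A_corner0 (u : A) : e0 * u = u -> u * e0 = u ->
  exists p0 p1 p2 p3, u = L p0 p1 p2 p3.
Proof. exact: (sys_corner0 char2 s_ge3 (Q2A_generators_system s c) Q2A_gen). Qed.

Lemma Q2A_corner1_comm (u v : A) : e1 * u = u -> u * e1 = u ->
  e1 * v = v -> v * e1 = v -> u * v = v * u.
Proof. exact: (sys_corner1_comm char2 s_ge3 (Q2A_generators_system s c) Q2A_gen). Qed.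

Lemma Q2A_socle_neq0 : z ^+ s.-1 * (a * (b * g)) != 0.
Proof.
have sE : s.-1.+1 = s by exact: ltn_predK s_ge3.
apply/eqP => E; have : L 0 0 0 'X^(s.-1) = 0.
  by rewrite /quad_elt !quad_Z0 !mul0r !add0r quad_ZXn.
move/Q2A_indep/(_ s.-1); rewrite sE => /(_ (leqnn _))[_ _ _].
by rewrite coefXn eqxx => /eqP; rewrite oner_eq0.
Qed.

End Q2ACorner.

(** * Comparison of the corners of the algebra and its twist *)

Lemma quad_corner_morphism (k : fieldType) (A B : algType k) (s : nat) (c d : k)
    (e x y : A) (e' x' y' : B) (r : nat) (theta : B -> A) :
  2%N \in [pchar k] -> s = (r.*2.+2)%N -> (0 < r)%N ->
  quad_basis s c e x y (local_z x y) -> quad_basis s d e' x' y' (local_z x' y') ->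
  (forall u, e * u = u -> u * e = u ->
     exists p0 p1 p2 p3, u = quad_elt e x y (local_z x y) p0 p1 p2 p3) ->
  (forall p0 p1 p2 p3, quad_elt e x y (local_z x y) p0 p1 p2 p3 = 0 ->
     forall i, (i < s)%N -> [/\ p0`_i = 0, p1`_i = 0, p2`_i = 0 & p3`_i = 0]) ->
  [/\ forall b b', theta (b + b') = theta b + theta b',
      forall t b, theta (t *: b) = t *: theta b,
      forall b b', b * e' = b -> theta (b * b') = theta b * theta b'
    & forall b, e * theta b = theta b /\ theta b * e = theta b] ->
  (forall b, e' * b = b -> b * e' = b -> theta b = 0 -> b = 0) ->
  local_z x' y' ^+ s.-1 * (x' * y') != 0 ->
  exists u w, [/\ u != 0, w != 0, u ^+ 2 = (u * w) ^+ s.-1 * w,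
                 w ^+ 2 = (u * w) ^+ s & c * u ^+ 2 = d * (u * w) ^+ s].
Proof.
move=> char2 sE r_gt0 HA HB span indep [tD tZ tM tc] inj nz.
set z' := local_z x' y' in HB nz *.
have ze := quad_ze HB; have xe := quad_xe HB; have ye := quad_ye HB.
have [ex [ey ez]] := (quad_ex HB, (quad_ey HB, quad_ez HB)).
have [p0 [p1 [p2 [p3 xE]]]] := span _ (tc x').1 (tc x').2.
have [q0 [q1 [q2 [q3 yE]]]] := span _ (tc y').1 (tc y').2.
have tzE : theta z' = theta x' * theta y' + theta y' * theta x'.
  by rewrite /z' /local_z tD !tM.
(* Since theta is multiplicative only for left factors in B e', the powers are peeled off on the
   left. *)
have tzX n w : theta (z' ^+ n * w) = theta z' ^+ n * theta w.
  elim: n => [|n IH]; first by rewrite !mul1r.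
  by rewrite !exprS -!mulrA tM // IH.
apply: (@quad_generators _ _ _ _ _ _ _ _ char2 HA r sE r_gt0 p0 p1 p2 p3 q0 q1 q2 q3 indep d);
  rewrite -xE -yE -tzE -!tM // -!tzX.
- by rewrite -tZ -tD (quad_xx HB).
- by rewrite (quad_yy HB).
(* The socle element lies in e' B e', where theta is injective. *)
apply: contraNneq nz => /inj -> //.
  by case: s sE {HA HB indep} => [|[|n]] // _; rewrite exprS !mulrA ez.
by rewrite -!mulrA ye.
Qed.

(** Only the scalar action changes, and c^2 acts on the twist as c acts on A. *)
Lemma quad_basis_twist (k : closedFieldType) (char2 : 2%N \in [pchar k])
    (A : algType k) s (c : k) (e x y z : A) : quad_basis s c e x y z ->
  @quad_basis k (frobenius_twist char2 1 A) s (c ^+ 2) e x y z.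
Proof.
case=> *; split=> //.
have fc : frobenius_inv char2 1 (c ^+ 2) = c.
  by apply: (@frobenius_inj _ _ char2 1); rewrite /= frobenius_invK.
rewrite -[_ *: _]/(frobenius_inv char2 1 (c ^+ 2) *: (_ : A)) fc.
by [].
Qed.

Lemma quad_morita_twist (k : closedFieldType) (char2 : 2%N \in [pchar k])
    (A : algType k) (s r : nat) (c : k) (e e1 x y : A) (aug : {rmorphism A -> k}) :
  let L := quad_elt e x y (local_z x y) in
  s = (r.*2.+2)%N -> (0 < r)%N -> quad_basis s c e x y (local_z x y) ->
  (forall u, e * u = u -> u * e = u -> exists p0 p1 p2 p3, u = L p0 p1 p2 p3) ->
  (forall p0 p1 p2 p3, L p0 p1 p2 p3 = 0 ->
     forall i, (i < s)%N -> [/\ p0`_i = 0, p1`_i = 0, p2`_i = 0 & p3`_i = 0]) ->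
  aug e = 1 -> (forall p0 p1 p2 p3, aug (L p0 p1 p2 p3) = p0`_0) ->
  e1 * e1 = e1 -> e + e1 = 1 ->
  (forall u v, e1 * u = u -> u * e1 = u -> e1 * v = v -> v * e1 = v -> u * v = v * u) ->
  x * y != y * x -> local_z x y ^+ s.-1 * (x * y) != 0 ->
  morita_equivalent A (frobenius_twist char2 1 A) ->
  exists u w, [/\ u != 0, w != 0, u ^+ 2 = (u * w) ^+ s.-1 * w,
                 w ^+ 2 = (u * w) ^+ s & c * u ^+ 2 = c ^+ 2 * (u * w) ^+ s].
Proof.
move=> L sE r_gt0 HA span indep auge augE e11 ee1 comm1 xyN socle.
case=> F [G [_ G_lin FG GF]].
have ee := quad_ee HA.
have loc u : e * u = u -> u * e = u -> aug u != 0 ->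
    exists u', [/\ e * u' = u', u' * e = u' & u * u' = e].
  move=> eu ue; have [p0 [p1 [p2 [p3 ->]]]] := span u eu ue.
  by rewrite augE; exact: (quad_unit char2 HA sE).
have [f [q [theta [fE [qq fq qf q0] [tD tZ tM tq tc] inj surj]]]] :=
  @morita_corner k A (frobenius_twist char2 1 A) F G G_lin FG GF e aug e e1
    ee auge loc ee e11 ee1.
case: fE => fE; subst f.
  have qe : q = e.
    (* The twist has the same underlying ring, so q is also an element of the corner of A and [span]
       applies to it. *)
    have [p0 [p1 [p2 [p3 qE]]]] := span q fq qf.
    by have [/eqP|//] := quad_idempotent char2 HA sE qE qq; rewrite (negPf q0).
  subst q; apply: (quad_corner_morphism char2 sE r_gt0 HA (quad_basis_twist char2 HA) span
    indep _ inj socle).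
  by split.
(* Here q lies in the e1-corner, so preimages of x and y commute, and theta would make x and y
   commute as well. *)
have [u [qu uq tu]] := surj x (quad_ex HA) (quad_xe HA).
have [v [qv vq tv]] := surj y (quad_ey HA) (quad_ye HA).
have l w : q * w = w -> e1 * w = w by move=> <-; rewrite mulrA fq.
have r' w : w * q = w -> w * e1 = w by move=> <-; rewrite -mulrA qf.
have uv : u * v = v * u by exact: (comm1 u v (l u qu) (r' u uq) (l v qv) (r' v vq)).
by move: xyN; rewrite -tu -tv -!tM // uv eqxx.
Qed.

Lemma Q2A_morita_twist (k : closedFieldType) (char2 : 2%N \in [pchar k]) (s r : nat) (c : k) :
  s = (r.*2.+2)%N -> (0 < r)%N ->
  morita_equivalent (Q2A s c) (frobenius_twist char2 1 (Q2A s c)) ->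
  exists u w, [/\ u != 0, w != 0, u ^+ 2 = (u * w) ^+ s.-1 * w,
                 w ^+ 2 = (u * w) ^+ s & c * u ^+ 2 = c ^+ 2 * (u * w) ^+ s].
Proof.
move=> sE r_gt0.
have s_ge3 : (2 < s)%N by rewrite sE; case: r r_gt0 {sE}.
have S := Q2A_generators_system s c.
have [aug [auge augE]] := Q2A_augmentation s c.
apply: (quad_morita_twist sE r_gt0 (Q2A_quad_basis c char2 s_ge3)
   (@Q2A_corner0 _ _ c char2 s_ge3) (@Q2A_indep _ _ c char2 s_ge3) auge augE
   (sys_e11 S) (sys_e1 S) (@Q2A_corner1_comm _ _ c char2 s_ge3)).
- exact: Q2A_xy_neq_yx.
exact: Q2A_socle_neq0.
Qed.
Lemma scalar_algC (k : fieldType) (A : algType k) (d : k) (r : A) : d%:A * r = r * d%:A.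
Proof. by rewrite mulr_algl mulr_algr. Qed.

(** [h] is a bare function, since it will be a composite of two maps that are each possibly only
    semilinear; only the composite is known to be linear. *)
Lemma Q2A_hom_id (k : fieldType) (s : nat) (c : k) (h : Q2A s c -> Q2A s c) :
  (forall u v, h (u + v) = h u + h v) -> (forall d u, h (d *: u) = d *: h u) ->
  (forall v, h (Q2A_vertex s c v) = Q2A_vertex s c v) ->
  (forall a u, h (Q2A_arrow s c a * u) = Q2A_arrow s c a * h u) -> forall u, h u = u.
Proof.
move=> hD hZ hv ha; elim/Q2A_ind => [|u v IH IH'|d u IH|v|a u IH].
- by apply: (addIr (h 0)); rewrite -hD !add0r.
- by rewrite hD IH IH'.
- by rewrite hZ IH.
- exact: hv.
by rewrite ha IH.
Qed.

Lemma lrmorphism_of (k : fieldType) (A B : algType k) (f : A -> B) :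
  (forall x y, f (x + y) = f x + f y) -> (forall x y, f (x * y) = f x * f y) ->
  f 1 = 1 -> (forall d x, f (d *: x) = d *: f x) ->
  exists g : {lrmorphism A -> B}, g =1 f.
Proof.
move=> fD fM f1 fZ.
have fB : zmod_morphism f.
  by move=> x y; rewrite fD -scaleN1r fZ scaleN1r.
pose g : {lrmorphism A -> B} := HB.pack f (GRing.isZmodMorphism.Build _ _ f fB)
  (GRing.isMonoidMorphism.Build _ _ f (conj f1 fM)) (GRing.isScalable.Build _ _ _ _ f fZ).
by exists g.
Qed.

Lemma lrmorphism_inverse (k : fieldType) (A B : algType k) (f : {lrmorphism A -> B})
    (g : B -> A) : cancel f g -> cancel g f ->
  [/\ forall x y, g (x + y) = g x + g y, forall x y, g (x * y) = g x * g y,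
      g 1 = 1 & forall d x, g (d *: x) = d *: g x].
Proof.
move=> fK gK; have fI : injective f by exact: can_inj fK.
split=> [x y|x y||d x]; apply: fI; rewrite gK.
- by rewrite rmorphD /= !gK.
- by rewrite rmorphM /= !gK.
- by rewrite rmorph1.
by rewrite linearZ /= gK.
Qed.

(** * Isomorphisms *)

Section Scaling.
Variables (k : fieldType) (A : algType k) (s : nat) (c d u w : k) (e0 e1 a b g : A).
Hypotheses (u0 : u != 0) (w0 : w != 0) (s_gt0 : (0 < s)%N).
Hypotheses (uw1 : u ^+ 2 = (u * w) ^+ s.-1 * w) (uw2 : w ^+ 2 = (u * w) ^+ s).
Hypothesis cd : c * u ^+ 2 = d * (u * w) ^+ s.

(** The relation for gbg requires w = (uw)^(s-1) u, which is [uw2] divided by w; the one for bgb is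
    [uw2]; the two terms of alpha^2 give [uw1] and [cd]. Gamma keeps its scale. *)
Lemma Q2A_system_scale : Q2A_system s c%:A e0 e1 a b g ->
  Q2A_system s d%:A e0 e1 (u *: a) (w *: b) g.
Proof.
move=> S; have sE : s.-1.+1 = s by exact: prednK.
have uws : (u * w) ^+ s.-1 * u = w.
  by apply: (mulIf w0); rewrite -mulrA -exprSr sE -uw2 expr2.
have uws' : (u * w) ^+ s.-1 * (u * w) = w * w by rewrite -exprSr sE -uw2 expr2.
have gab : g * (u *: a) * (w *: b) = (u * w) *: (g * a * b).
  by rewrite -!scalerAr -scalerAl scalerA mulrC.
have abg : u *: a * (w *: b) * g = (u * w) *: (a * b * g).
  by rewrite -!scalerAr -!scalerAl scalerA mulrC.
have bga : w *: b * g * (u *: a) = (u * w) *: (b * g * a).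
  by rewrite -!scalerAr -!scalerAl scalerA.
case: S => e00 e01 e10 e11 ee e0a ae0 e0b be1 e1g ge0 gbg bgb aa aab; split => //.
- by rewrite -scalerAr e0a.
- by rewrite -scalerAl ae0.
- by rewrite -scalerAr e0b.
- by rewrite -scalerAl be1.
- rewrite gab exprZn; have -> : g * (w *: b) * g = w *: (g * b * g).
    by rewrite -scalerAr -scalerAl.
  by rewrite gbg -[g * (u *: a)]scalerAr -scalerAl -scalerAr scalerA uws.
- rewrite abg exprZn; have -> : w *: b * g * (w *: b) = (w * w) *: (b * g * b).
    by rewrite -scalerAr -!scalerAl scalerA.
  have -> : u *: a * (w *: b) = (u * w) *: (a * b).
    by rewrite -scalerAr -scalerAl scalerA mulrC.
  by rewrite bgb -scalerAl -scalerAr scalerA uws'.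
- rewrite bga !exprZn aa scalerDr !mulr_algl scalerA [u ^+ 2 * c]mulrC cd.
  rewrite -[w *: b * g]scalerAl -!scalerAl -!scalerAr !scalerA uw1.
  by rewrite -[d * _ * _]mulrA -[_ * (u * w)]exprSr sE.
by rewrite exprZn -scalerAl -scalerAr aab !scaler0.
Qed.
End Scaling.

Lemma Q2A_alg_lift (k : fieldType) (s : nat) (c : k) (R : algType k) (e0 e1 a b g : R) :
  Q2A_system s c%:A e0 e1 a b g -> exists f : {rmorphism Q2A s c -> R},
   [/\ forall d u, f (d *: u) = d *: f u,
       forall v, f (Q2A_vertex s c v) = if v is V0 then e0 else e1
     & forall x, f (Q2A_arrow s c x) =
         match x with Alpha => a | Beta => b | Gamma => g end].
Proof.
move=> S; have [f [fZ fv fa]] := @Q2A_lift k s c R (in_alg R) (@scalar_algC k R) _ _ _ _ _ S.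
by exists f; split=> // d u; rewrite fZ mulr_algl.
Qed.

Lemma Q2A_scale_isomorphic (k : fieldType) (s : nat) (c d u w : k) :
  u != 0 -> w != 0 -> (0 < s)%N ->
  u ^+ 2 = (u * w) ^+ s.-1 * w -> w ^+ 2 = (u * w) ^+ s -> c * u ^+ 2 = d * (u * w) ^+ s ->
  algebra_isomorphic (Q2A s d) (Q2A s c).
Proof.
move=> u0 w0 s0 uw1 uw2 cd.
have [f [fZ fv fa]] := Q2A_alg_lift
  (Q2A_system_scale w0 s0 uw1 uw2 cd (Q2A_generators_system s c)).
(* The inverse rescales by the inverse scalars: the conditions are symmetric under inverting u and w
   and exchanging c and d. *)
have [h [hZ hv ha]] : exists h : {rmorphism Q2A s c -> Q2A s d},
   [/\ forall t v, h (t *: v) = t *: h v,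
       forall v, h (Q2A_vertex s c v) = if v is V0 then Q2A_vertex s d V0 else Q2A_vertex s d V1
     & forall x, h (Q2A_arrow s c x) =
         match x with Alpha => u^-1 *: Q2A_arrow s d Alpha
         | Beta => w^-1 *: Q2A_arrow s d Beta | Gamma => Q2A_arrow s d Gamma end].
  apply: Q2A_alg_lift; apply: (@Q2A_system_scale _ _ s d c u^-1 w^-1);
    rewrite ?invr_neq0 // -?invfM ?exprVn; last exact: Q2A_generators_system.
  - by rewrite uw1 invfM.
  - by rewrite uw2.
  have uw0 : (u * w) ^+ s != 0 by rewrite expf_neq0 ?mulf_neq0.
  have u20 : u ^+ 2 != 0 by rewrite expf_neq0.
  by apply/eqP; rewrite eqr_div // cd.
have [F FE] := lrmorphism_of (rmorphD f) (rmorphM f) (rmorph1 f) fZ.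
exists F; exists h => v; rewrite FE.
  apply: (Q2A_hom_id (h := h \o f)) => /= [x y|t x|x|x y].
  - by rewrite !rmorphD.
  - by rewrite fZ hZ.
  - by rewrite fv; case: x; rewrite hv.
  - rewrite !rmorphM fa; case: x; rewrite ?hZ ?ha ?scalerA ?divff ?scale1r //.
apply: (Q2A_hom_id (h := f \o h)) => /= [x y|t x|x|x y].
- by rewrite !rmorphD.
- by rewrite hZ fZ.
- by rewrite hv; case: x; rewrite fv.
rewrite !rmorphM ha; case: x; rewrite ?fZ ?fa ?scalerA ?mulVf ?scale1r //.
Qed.

(** Semilinearity of P for the inverse Frobenius is exactly linearity of P as a map into the
    twist. *)
Lemma morita_twist_semilinear (k : closedFieldType) (char2 : 2%N \in [pchar k])
    (A : algType k) (P Q : A -> A) :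
  (forall x y, P (x + y) = P x + P y) -> (forall x y, P (x * y) = P x * P y) ->
  P 1 = 1 -> (forall d x, P (d *: x) = frobenius_inv char2 1 d *: P x) ->
  cancel P Q -> cancel Q P -> morita_equivalent A (frobenius_twist char2 1 A).
Proof.
move=> PD PM P1 PZ PQ QP.
have [p pE] := @lrmorphism_of k A (frobenius_twist char2 1 A) P PD PM P1 PZ.
have pQ : cancel p Q by move=> x; rewrite pE.
have Qp : cancel Q p by move=> x; rewrite pE.
have [QD QM Q1 QZ] := lrmorphism_inverse pQ Qp.
have [q qE] := lrmorphism_of QD QM Q1 QZ.
by apply: (@morita_equivalent_isomorphic _ _ _ p q) => x; rewrite qE ?pQ ?Qp.
Qed.

(** * Parameters fixed by the Frobenius *)

Section FrobeniusFixed.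
Variables (k : closedFieldType) (char2 : 2%N \in [pchar k]) (s : nat) (c : k).
Hypothesis cc : c ^+ 2 = c.
Local Notation A := (Q2A s c).

Lemma Q2A_semilinear_lift (sigma : {rmorphism k -> k}) : sigma c = c ->
  exists f : {rmorphism A -> A},
   [/\ forall d u, f (d *: u) = sigma d *: f u,
       forall v, f (Q2A_vertex s c v) = Q2A_vertex s c v
     & forall x, f (Q2A_arrow s c x) = Q2A_arrow s c x].
Proof.
move=> sc; have C d r : (in_alg A \o sigma) d * r = r * (in_alg A \o sigma) d.
  exact: scalar_algC.
have S : Q2A_system s ((in_alg A \o sigma) c)
    (Q2A_vertex s c V0) (Q2A_vertex s c V1)
    (Q2A_arrow s c Alpha) (Q2A_arrow s c Beta) (Q2A_arrow s c Gamma).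
  by rewrite /= sc; exact: Q2A_generators_system.
have [f [fZ fv fa]] := Q2A_lift C S.
exists f; split=> [d u|[]|[]]; rewrite ?fv ?fa //.
by rewrite fZ /= mulr_algl.
Qed.

Lemma Q2A_frobenius : exists f h : {rmorphism A -> A},
  [/\ cancel f h, cancel h f & forall d u, f (d *: u) = frobenius_inv char2 1 d *: f u].
Proof.
have fK d : frobenius_inv char2 1 d ^+ 2 = d by exact: frobenius_invK.
have Kf d : frobenius_inv char2 1 (d ^+ 2) = d.
  by apply: (@frobenius_inj _ _ char2 1); rewrite /= frobenius_invK.
have [f [fZ fv fa]] :=
  @Q2A_semilinear_lift (frobenius_inv char2 1) (etrans (congr1 _ (esym cc)) (Kf c)).
have [h [hZ hv ha]] := @Q2A_semilinear_lift (pFrobenius_aut char2) cc.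
exists f, h; split; last exact: fZ.
  move=> v; apply: (Q2A_hom_id (h := h \o f)) => /= [x y|t x|x|x y].
  - by rewrite !rmorphD.
  - by rewrite fZ hZ /= pFrobenius_autE fK.
  - by rewrite fv hv.
  by rewrite !rmorphM fa ha.
move=> v; apply: (Q2A_hom_id (h := f \o h)) => /= [x y|t x|x|x y].
- by rewrite !rmorphD.
- by rewrite hZ fZ /= pFrobenius_autE Kf.
- by rewrite hv fv.
by rewrite !rmorphM ha fa.
Qed.

Lemma Q2A_morita_twist_fixed (A' : algType k) :
  algebra_isomorphic A' A -> morita_equivalent A' (frobenius_twist char2 1 A').
Proof.
move=> [F [G FG GF]]; have [f [h [fh hf fZ]]] := Q2A_frobenius.
have [GD GM G1 GZ] := lrmorphism_inverse FG GF.
have FD := rmorphD F; have FM := rmorphM F; have F1 := rmorph1 F.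
have fD := rmorphD f; have fM := rmorphM f; have f1 := rmorph1 f.
have FZ d x : F (d *: x) = d *: F x by exact: linearZ.
apply: (morita_twist_semilinear (P := fun x => G (f (F x))) (Q := fun x => G (h (F x)))).
- by move=> x y; rewrite FD fD GD.
- by move=> x y; rewrite FM fM GM.
- by rewrite F1 f1 G1.
- by move=> d x; rewrite FZ fZ GZ.
- by move=> x; rewrite GF fh FG.
by move=> x; rewrite GF hf FG.
Qed.
End FrobeniusFixed.

Lemma F2_sqr (x : 'F_2) : x ^+ 2 = x.
Proof. by apply: val_inj; case: x => -[|[|]]. Qed.

Theorem proposition4p3 (k : closedFieldType) (char2 : 2%N \in [pchar k])
    (iota : {rmorphism 'F_2 -> k}) (k_alg : forall x : k, algebraicOver iota x)
    (n : nat) (n_ge4 : (4 <= n)%N) (c : k) :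
  is_morita_frobenius_number char2 (Q2A (2 ^ (n - 2)) c) 1 <->
  exists c' : 'F_2,
    algebra_isomorphic (Q2A (2 ^ (n - 2)) c) (Q2A (2 ^ (n - 2)) (iota c')).
Proof.
have [r sE r_gt0] : exists2 r, (2 ^ (n - 2))%N = (r.*2.+2)%N & (0 < r)%N.
  (* Solving 2r + 2 = 2^(n-2) gives r = 2^(n-3) - 1, which is positive because n >= 4. *)
  exists (2 ^ (n - 3)).-1; last first.
    by rewrite -ltnS prednK ?expn_gt0 // -{1}(expn0 2) ltn_exp2l // subn_gt0.
  rewrite -doubleS prednK ?expn_gt0 // -mul2n -expnS; congr (2 ^ _)%N.
  by rewrite -subSn // ltnW.
split=> [[_ M _] | [c' iso]].
  have [u [w [u0 w0 uw1 uw2 cuw]]] := Q2A_morita_twist sE r_gt0 M.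
  have s_gt0 : (0 < 2 ^ (n - 2))%N by rewrite sE.
  (* The parameter 0 already comes from F_2. Otherwise c cancels from the last equation, leaving u^2
     = c (uw)^s, the condition for rescaling between the parameters 1 and c. *)
  have [->|c0] := eqVneq c 0.
    by exists 0; rewrite rmorph0; exists idfun; exists id.
  exists 1; rewrite rmorph1; apply: (Q2A_scale_isomorphic u0 w0 s_gt0 uw1 uw2).
  by apply: (mulfI c0); rewrite mul1r cuw expr2 mulrA.
(* The number 1 is automatically minimal, so only the equivalence with the first twist remains. *)
split=> //.
by apply: Q2A_morita_twist_fixed iso; rewrite -rmorphXn F2_sqr.
Qed.
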